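(* Let $\lambda$ be a nonempty partition with $\ell(\lambda)<n$, let $P_1,\ldots,P_s\in F_{\lambda,n}$ ($s\ge1$) be general points, and let $Q\in\langle P_1,\ldots,P_s\rangle$ be general. Then $$\left(\widehat T_Q\sigma_s(F_{\lambda,n})\right)^\perp=\bigcap_{i=1}^s\left(I_{\mathrm S}(P_i)^{\langle2\rangle}\right)_\lambda.$$ Consequently, $$\dim\sigma_s(F_{\lambda,n})=N_{\lambda,n}-\dim\left(\bigcap_{i=1}^s\left(I_{\mathrm S}(P_i)^{\langle2\rangle}\right)_\lambda\right),$$ where $N_{\lambda,n}=\dim\mathbb{S}_\lambda V-1$.
   Context: $V$ is a complex vector space of dimension $n$; $G=\mathrm{GL}(V)$. For a partition $\alpha$ with $\ell(\alpha)\le n$, $\mathbb{S}_\alpha V$ is the irreducible polynomial $G$-module of highest weight $\alpha$, $\mathbb{S}_\alpha V^*$ is its dual, and $\alpha'$ is the conjugate partition. Put $\mathbb{S}^\bullet V^*=\bigoplus_{\ell(\alpha)\le n}\mathbb{S}_\alpha V^*$; for a subspace $A\subseteq\mathbb{S}^\bullet V^*$, $(A)_\alpha=A\cap\mathbb{S}_\alpha V^*$. Geometry. $F_{\lambda,n}\subseteq\mathbb{P}(\mathbb{S}_\lambda V)$ is the unique closed $G$-orbit, i.e. the orbit of the class of a highest-weight vector. For an irreducible nondegenerate projective variety $X\subseteq\mathbb{P}(W)$, $\sigma_s(X)$ is the Zariski closure of the union of the linear spans $\langle P_1,\dots,P_s\rangle$ with $P_i\in X$. $\widehat T_PX\subseteq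 W$ is the affine tangent space: the Zariski tangent space to the affine cone over $X$ at a nonzero representative of a smooth point $P$. ''General'' means: in a suitable nonempty Zariski open subset of the relevant irreducible parameter space. Schur apolarity action. Realize $\mathbb{S}_\alpha V$ (resp. $\mathbb{S}_\alpha V^*$) as the unique $G$-submodule of that isomorphism type in $\bigotimes_{c}\bigwedge^{\alpha'_c}V$ (resp. $\bigotimes_c\bigwedge^{\alpha'_c}V^*$). For $\mu\subseteq\lambda$ (put $\mu'_c=0$ for $c>\mu_1$), the action $*:\mathbb{S}_\mu V^*\otimes\mathbb{S}_\lambda V\to\mathbb{S}_{\lambda/\mu}V\subseteq\bigotimes_{c=1}^{\lambda_1}\bigwedge^{\lambda'_c-\mu'_c}V$ is the restriction of the tensor product over $c$ of the usual skew-symmetric contractions $\bigwedge^{\mu'_c}V^*\otimes\bigwedge^{\lambda'_c}V\to\bigwedge^{\lambda'_c-\mu'_c}V$; here $\mathbb{S}_{\lambda/\mu}V$ is the skew Schur module. If $\mu\not\subseteq\lambda$ the action is zero. It is extended componentwise to $\mathbb{S}^\bullet V^*\otimes\mathbb{S}_\lambda V\to\bigoplus_{\mu\subseteq\lambda}\mathbb{S}_{\lambda/\mu}V$. For $\mu=\lambda$ it is a perfect pairing, a nonzero scalar multiple of the evaluation pairing, and $U^\perp=\{\varphi\in\mathbb{S}_\lambda V^*\mid\varphi*u=0\ \forall u\in U\}$ for $U\subseteq\mathbb{S}_\lambda V$. Geometric Schur square. The $G$-action on each $\mathbb{S}_\alpha V^*$ differentiates to an action of $\mathfrak{gl}(V)$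 on $\mathbb{S}^\bullet V^*$. For $P=[p]\in\mathbb{P}(\mathbb{S}_\lambda V)$, $$I_{\mathrm S}(P)^{\langle2\rangle}=\{\varphi\in\mathbb{S}^\bullet V^*\mid\varphi*p=0\text{ and }(\xi\cdot\varphi)*p=0\text{ for every }\xi\in\mathfrak{gl}(V)\}.$$ *)

(* Defs.v *)
(* V is the space K^n of column vectors, G = GL(V) the invertible n x n
   matrices, and V^* is identified with K^n by the dual basis.  Definitions are
   over a field K; the formulas with 1/k! and with alternating tensors in place
   of exterior powers are meant for characteristic 0. *)
From mathcomp Require Import all_boot all_order all_fingroup all_algebra.
From mathcomp Require Import boolp classical_sets reals.
From mathcomp Require Export complex mpoly.

Set Implicit Arguments.
Unset Strict Implicit.
Unset Printing Implicit Defensive.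

Import GRing.Theory.
Local Open Scope classical_set_scope.
Local Open Scope ring_scope.

(** * Projective geometry in P(E) *)

Definition proj (K : fieldType) (E : vectType K) : Type :=
  {L : {vspace E} | \dim L == 1%N}.

(* P = [p] is read as p \in line P together with p != 0. *)
Definition line (K : fieldType) (E : vectType K) (P : proj E) : {vspace E} :=
  sval P.

(* Polynomial functions on E are written in the coordinates of a fixed basis;
   no notion below depends on that basis. *)
Definition ndim (K : fieldType) (E : vectType K) : nat := \dim {:E}.

Definition crd (K : fieldType) (E : vectType K) (v : E) : 'I_(ndim E) -> K :=
  fun i => coord (vbasis {:E}) i v.

Definition ev (K : fieldType) (E : vectType K) (f : {mpoly K[ndim E]}) (v : E) :
    K :=
  f.@[crd v].

Definition differential (K : fieldType) (E : vectType K)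
    (f : {mpoly K[ndim E]}) (q w : E) : K :=
  \sum_(i < ndim E) ev f^`M(i) q * crd w i.

(* Vanishing on the whole line means that every homogeneous component of f
   vanishes at P (K infinite), so J need not consist of homogeneous elements. *)
Definition zariski_closed (K : fieldType) (E : vectType K)
    (Z : set (proj E)) : Prop :=
  exists J : set {mpoly K[ndim E]}, forall P, Z P <->
    (forall f, J f -> forall v, v \in line P -> ev f v = 0).

Definition zariski_open (K : fieldType) (E : vectType K)
    (O : set (proj E)) : Prop := zariski_closed (~` O).

Definition zariski_closure (K : fieldType) (E : vectType K)
    (X : set (proj E)) : set (proj E) :=
  [set P | forall Z, zariski_closed Z -> X `<=` Z -> Z P].

(* Zariski topology of the product P(E)^s: as above, with multihomogeneous
   components of polynomials on E^s. *)
Definition zariski_closed_prod (K : fieldType) (E : vectType K) (s : nat)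
    (Z : set ('I_s -> proj E)) : Prop :=
  exists J : set {mpoly K[ndim {ffun 'I_s -> E}]}, forall P, Z P <->
    (forall f, J f -> forall v : {ffun 'I_s -> E},
       (forall i, v i \in line (P i)) -> ev f v = 0).

Definition zariski_open_prod (K : fieldType) (E : vectType K) (s : nat)
    (O : set ('I_s -> proj E)) : Prop := zariski_closed_prod (~` O).

(* "A general point x of Z satisfies Phi", where [op] says which subsets of the
   ambient type T are open. *)
Definition general (T : Type) (op : set (set T)) (Z : set T) (Phi : T -> Prop) :
    Prop :=
  exists O, [/\ op O, Z `&` O !=set0 & forall x, Z x -> O x -> Phi x].

Definition linear_span (K : fieldType) (E : vectType K) (s : nat)
    (P : 'I_s -> proj E) : set (proj E) :=
  [set Q | (line Q <= \sum_(i < s) line (P i))%VS].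

Definition secant_variety (K : fieldType) (E : vectType K) (s : nat)
    (X : set (proj E)) : set (proj E) :=
  zariski_closure
    [set Q | exists P : 'I_s -> proj E,
       (forall i, X (P i)) /\ linear_span P Q].

Definition cone_ideal (K : fieldType) (E : vectType K) (X : set (proj E)) :
    set {mpoly K[ndim E]} :=
  [set f | forall P, X P -> forall v, v \in line P -> ev f v = 0].

(* The defining condition does not depend on the representative q of Q. *)
Definition affine_tangent (K : fieldType) (E : vectType K) (X : set (proj E))
    (Q : proj E) : set E :=
  [set w | forall q, q \in line Q -> q != 0 ->
     forall f, cone_ideal X f -> differential f q w = 0].

(* For X irreducible: the function field of X contains d algebraically
   independent elements f_i / g (written with a common denominator). *)
Definition alg_indep_functions (K : fieldType) (E : vectType K)
    (X : set (proj E)) (d : nat) : Prop :=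
  exists (e : nat) (g : {mpoly K[ndim E]}) (f : 'I_d -> {mpoly K[ndim E]}),
    [/\ g \is e.-homog, forall i, f i \is e.-homog &
        forall G : {mpoly K[d]}, G != 0 ->
          exists P v, [/\ X P, v \in line P, ev g v != 0 &
                          G.@[fun i => ev (f i) v / ev g v] != 0]].

(* Dimension of an irreducible projective variety X: the transcendence degree
   of its function field (which is at most ndim E). *)
Definition proj_dim (K : fieldType) (E : vectType K) (X : set (proj E)) : nat :=
  \max_(d < (ndim E).+1 | `[< alg_indep_functions X d >]) d.

(* Dimension of a linear subspace given as a set. *)
Definition lin_dim (K : fieldType) (E : vectType K) (A : set E) : nat :=
  \dim (xget 0%VS [set U : {vspace E} | [set` U] = A]).

(** * Partitions, diagrams and tensors *)

Definition is_partition (a : seq nat) : bool := sorted geq a && (0%N \notin a).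

Definition part (n : nat) : Type :=
  {a : seq nat | is_partition a && (size a <= n)%N}.

Definition parts (n : nat) (a : part n) : seq nat := sval a.

Definition conj_part (a : seq nat) (c : nat) : nat :=
  count (fun x => (c < x)%N) a.

Definition sub_part (mu la : seq nat) : bool :=
  all (fun r => nth 0 mu r <= nth 0 la r)%N (iota 0 (size mu)).

(* Cells (r, c) = (row, column) of the skew diagram la/mu, with mu_r <= c < la_r;
   column c consists of the rows r with mu'_c <= r < la'_c. *)
Definition skew_diagram (la mu : seq nat) : seq (nat * nat) :=
  [seq (r, c) | r <- iota 0 (size la),
                c <- iota (nth 0 mu r) (nth 0 la r - nth 0 mu r)]%N.

Definition diagram (la : seq nat) : seq (nat * nat) := skew_diagram la [::].

Definition filling (n : nat) (D : seq (nat * nat)) : Type :=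
  {ffun seq_sub D -> 'I_n}.

(* Tensor power of V (or V^* ) with one factor for each cell of D: the filling f
   indexes the basis vector \bigotimes_x e_(f x). *)
Definition tens (K : fieldType) (n : nat) (D : seq (nat * nat)) : Type :=
  {ffun filling n D -> K^o}.

(* \bigotimes_c \bigwedge^(k_c) V inside the tensor power, k_c being the number
   of cells in column c: the tensors alternating in each column, where
   v_1 /\ ... /\ v_k is \sum_s sgn(s) v_(s 1) (x) ... (x) v_(s k). *)
Definition column_alternating (K : fieldType) (n : nat) (D : seq (nat * nat))
    (t : tens K n D) : Prop :=
  forall (f : filling n D) (x y : seq_sub D),
    x != y -> (val x).2 = (val y).2 ->
    t [ffun z => f (tperm x y z)] = - t f.

Definition act (K : fieldType) (n : nat) (D : seq (nat * nat)) (g : 'M[K]_n)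
    (t : tens K n D) : tens K n D :=
  [ffun f : filling n D =>
     \sum_(k : filling n D) (\prod_(x : seq_sub D) g (f x) (k x)) * t k].

Definition act_dual (K : fieldType) (n : nat) (D : seq (nat * nat))
    (g : 'M[K]_n) (phi : tens K n D) : tens K n D :=
  act (invmx g)^T phi.

(* The differential at the identity of g |-> act_dual g phi. *)
Definition lie_dual (K : fieldType) (n : nat) (D : seq (nat * nat))
    (xi : 'M[K]_n) (phi : tens K n D) : tens K n D :=
  [ffun f : filling n D =>
     - \sum_(x : seq_sub D) \sum_(j < n)
         xi j (f x) * phi [ffun z => if z == x then j else f z]].

(** * Schur modules *)

(* v is an eigenvector of the upper triangular Borel subgroup, of weight a. *)
Definition highest_weight_vector (K : fieldType) (n : nat)
    (D : seq (nat * nat)) (a : seq nat) (v : tens K n D) : Prop :=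
  v != 0 /\
  forall b : 'M[K]_n, b \in unitmx ->
    (forall i j : 'I_n, (j < i)%N -> b i j = 0) ->
    act b v = (\prod_(i < n) b i i ^+ nth 0%N a i) *: v.

Definition gl_stable (K : fieldType) (n : nat) (D : seq (nat * nat))
    (S : {vspace tens K n D}) : Prop :=
  forall g t, g \in unitmx -> t \in S -> act g t \in S.

Definition is_schur (K : fieldType) (n : nat) (a : seq nat)
    (S : {vspace tens K n (diagram a)}) : Prop :=
  [/\ forall t, t \in S -> column_alternating t,
      gl_stable S,
      S != 0%VS /\ (forall U, (U <= S)%VS -> gl_stable U -> U = 0%VS \/ U = S)
    & exists2 v, v \in S & highest_weight_vector a v].

(* The unique submodule as above; it exists for a partition a of length <= n. *)
Definition schur (K : fieldType) (n : nat) (a : seq nat) :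
    {vspace tens K n (diagram a)} :=
  xget 0%VS [set S | is_schur S].

(* S is isomorphic to the dual of the Schur module: there is a G-invariant
   perfect pairing between them. *)
Definition is_schur_dual (K : fieldType) (n : nat) (a : seq nat)
    (S : {vspace tens K n (diagram a)}) : Prop :=
  [/\ forall phi, phi \in S -> column_alternating phi,
      forall g phi, g \in unitmx -> phi \in S -> act_dual g phi \in S
    & exists b : tens K n (diagram a) -> tens K n (diagram a) -> K,
      [/\ forall c x y u, b (c *: x + y) u = c * b x u + b y u,
          forall c x u v, b x (c *: u + v) = c * b x u + b x v,
          forall g phi u, g \in unitmx -> phi \in S -> u \in schur K n a ->
            b (act_dual g phi) (act g u) = b phi u,
          forall phi, phi \in S ->
            (forall u, u \in schur K n a -> b phi u = 0) -> phi = 0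
        & forall u, u \in schur K n a ->
            (forall phi, phi \in S -> b phi u = 0) -> u = 0]].

Definition schur_dual (K : fieldType) (n : nat) (a : seq nat) :
    {vspace tens K n (diagram a)} :=
  xget 0%VS [set S | is_schur_dual S].

(* The space S_la V as a vector space in its own right. *)
Definition schur_space (K : fieldType) (n : nat) (la : seq nat) : vectType K :=
  subvs_of (schur K n la).

Definition flag_variety (K : fieldType) (n : nat) (la : seq nat) :
    set (proj (schur_space K n la)) :=
  [set P | exists (v : schur_space K n la) (g : 'M[K]_n)
             (p : schur_space K n la),
     [/\ highest_weight_vector la (vsval v), g \in unitmx,
         vsval p = act g (vsval v) & line P = <[p]>%VS]].

(** * Schur apolarity *)

(* The fillings agree on the cells common to both shapes. *)
Definition agree (n : nat) (D D' : seq (nat * nat)) (f : filling n D)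
    (k : filling n D') : bool :=
  [forall x : seq_sub D, forall y : seq_sub D',
     (val x == val y) ==> (f x == k y)].

(* In column c the first mu'_c factors of t are contracted with phi.  On
   alternating tensors, the full contraction of /\^k V^* against the first k
   factors is k! times the skew-symmetric contraction, whence the scalar. *)
Definition apolar (K : fieldType) (n : nat) (mu la : seq nat)
    (phi : tens K n (diagram mu)) (t : tens K n (diagram la)) :
    tens K n (skew_diagram la mu) :=
  if sub_part mu la then
    (\prod_(c < head 0%N mu) (conj_part mu c)`!%:R)^-1 *:
    [ffun h : filling n (skew_diagram la mu) =>
       \sum_(f : filling n (diagram mu))
         \sum_(k : filling n (diagram la) | agree f k && agree h k)
           phi f * t k]
  else 0.

Definition perp (K : fieldType) (n : nat) (la : seq nat)
    (U : set (schur_space K n la)) : set (tens K n (diagram la)) :=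
  [set phi | phi \in schur_dual K n la /\
     forall u, U u -> apolar phi (vsval u) = 0].

(* Families of tensors indexed by the partitions of length at most n; the
   direct sum of the S_a V^* is the set [schur_sum] of such families. *)
Definition tensor_family (K : fieldType) (n : nat) : Type :=
  forall a : part n, tens K n (diagram (parts a)).

Definition schur_sum (K : fieldType) (n : nat) : set (tensor_family K n) :=
  [set phi | (forall a, phi a \in schur_dual K n (parts a)) /\
             (exists s : seq (part n), forall a, a \notin s -> phi a = 0)].

Definition single (K : fieldType) (n : nat) (la : part n)
    (phi : tens K n (diagram (parts la))) : tensor_family K n :=
  dfwith (fun a : part n => 0 : tens K n (diagram (parts a))) phi.

(* (A)_la, i.e. the intersection of A with the summand S_la V^*. *)
Definition component (K : fieldType) (n : nat) (A : set (tensor_family K n))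
    (la : part n) : set (tens K n (diagram (parts la))) :=
  [set phi | phi \in schur_dual K n (parts la) /\ A (single phi)].
Arguments component {K n} A la _ : rename.

Definition family_apolar0 (K : fieldType) (n : nat) (la : seq nat)
    (phi : tensor_family K n) (p : tens K n (diagram la)) : Prop :=
  forall mu : part n, apolar (phi mu) p = 0.

Definition family_lie (K : fieldType) (n : nat) (xi : 'M[K]_n)
    (phi : tensor_family K n) : tensor_family K n :=
  fun a => lie_dual xi (phi a).

(* The geometric Schur square I_S(P)^<2>. *)
Definition schur_square (K : fieldType) (n : nat) (la : seq nat)
    (P : proj (schur_space K n la)) : set (tensor_family K n) :=
  [set phi | schur_sum phi /\
     forall p, p \in line P ->
       family_apolar0 phi (vsval p) /\
       (forall xi : 'M[K]_n, family_apolar0 (family_lie xi phi) (vsval p))].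

(* Main.v *)
Require Import Defs.
From HB Require Import structures.
From mathcomp Require Import all_boot all_order all_fingroup all_algebra.
From mathcomp Require Import boolp classical_sets reals.
(* [all_fingroup] hides the [act] of Defs. *)
Import Defs.

Set Implicit Arguments.
Unset Strict Implicit.
Unset Printing Implicit Defensive.

Import Order.TTheory GRing.Theory Num.Theory.
Local Open Scope ring_scope.

(* The theorem is Terracini's lemma for the closed orbit.

   Representation theory.  On tensors alternating in the columns, the
   one-parameter torus diag(1, 2, 4, ...) has a one-dimensional extremal weight
   space, spanned by the tensor product over the columns of
   e_1 /\ ... /\ e_k.  The unitary trick then shows that this tensor generates
   an irreducible module, which is its own dual inside the tensor power for the
   standard bilinear form.  For that form the infinitesimal action on
   functionals is minus the transpose of the action on vectors, so the
   component of degree lambda of the intersection of the geometric Schur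
   squares is the orthogonal of the sum T of the spaces gl.p_i (each contains
   p_i by Euler's identity).

   Geometry.  In characteristic 0 polynomials with dependent differentials are
   algebraically dependent: restrict them to a linear slice transversal to the
   kernels of the differentials, which loses no relation, and count monomials.
   Applied to the parametrization sum_i a_i g_i v of the cone over the secant
   variety, whose differential has image T, this identifies T with the general
   tangent space and gives the dimension. *)

(** The tangent space is cut out by the whole ideal of the closure, and no generators of that ideal
    are at hand. That it contains T is the chain rule. The opposite bound needs enough equations,
    and these are algebraic relations: once r coordinates with independent differentials are chosen,
    every coordinate satisfies a relation over them whose last partial derivative does not vanish
    identically. Generality then means that finitely many explicit polynomials are nonzero.
    Characteristic 0 enters mainly through one principle: a class of polynomials that is closed
    under partial derivatives and contains no nonzero constant is zero. The Schur modules are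
    defined by choice among the subspaces meeting a specification, so existence is not enough: every
    candidate has to be tied to the same extremal tensor before anything can be computed. An
    algebraically closed field with conjugation supplies both the Hermitian form and the roots that
    rescale points of a cone. *)

(** * Derivations, substitution and vanishing of polynomials *)

Lemma mpoly_ind_ring (R : comNzRingType) (m : nat) (P : {mpoly R[m]} -> Prop) :
  (forall c, P c%:MP) -> (forall i, P 'X_i) ->
  (forall p q, P p -> P q -> P (p + q)) ->
  (forall p q, P p -> P q -> P (p * q)) -> forall p, P p.
Proof.
move=> PC PX PD PM; elim/mpolyind=> [|c mm p _ _ Pp]; first exact: PC 0.
apply: PD => //; rewrite -mul_mpolyC; apply: (PM) => //.
rewrite mpolyXE_id; apply: big_ind => // [|i _]; first exact: PC 1.
elim: (mm i) => [|k IHk]; first exact: PC 1.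
by rewrite exprS; apply: PM.
Qed.

Lemma mderivXU (R : nzRingType) (m : nat) (i j : 'I_m) :
  ('X_i : {mpoly R[m]})^`M(j) = (i == j)%:R.
Proof.
rewrite mderivX mnm1E; case: eqP => [->|_]; last by rewrite scale0r.
rewrite scale1r (_ : (U_(j) - U_(j) = 0)%MM) ?mpolyX0 //.
by apply/mnmP=> k; rewrite mnmBE mnm0E subnn.
Qed.

(** The chain rule for any derivation that kills the coefficients: it serves partial derivatives of
    a substitution as well as the derivative of a restriction to a line. *)
Lemma derivation_mmap (R A : comNzRingType) (h : {rmorphism R -> A})
    (m : nat) (y : 'I_m -> A) (D : A -> A) (p : {mpoly R[m]}) :
  (forall a b, D (a + b) = D a + D b) ->
  (forall a b, D (a * b) = D a * b + a * D b) ->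
  (forall c, D (h c) = 0) ->
  D (mmap h y p) = \sum_i mmap h y p^`M(i) * D (y i).
Proof.
move=> DD DM DC; elim/mpoly_ind_ring: p => [c|i|p q IHp IHq|p q IHp IHq].
- rewrite mmapC DC big1 // => i _; by rewrite mderivC mmap0 mul0r.
- rewrite mmapX mmap1U (bigD1 i) //= big1 => [|j ji].
    by rewrite mderivXU eqxx rmorph1 mul1r addr0.
  by rewrite mderivXU eq_sym (negbTE ji) mmap0 mul0r.
- rewrite mmapD DD IHp IHq -big_split; apply: eq_bigr => i _ /=.
  by rewrite mderivD mmapD mulrDl.
- rewrite rmorphM DM IHp IHq mulr_suml mulr_sumr -big_split.
  apply: eq_bigr => i _ /=.
  by rewrite mderivM mmapD !rmorphM /= mulrDl mulrAC mulrA.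
Qed.

Definition msubst (R : comNzRingType) (m k : nat) (y : 'I_m -> {mpoly R[k]}) :
  {mpoly R[m]} -> {mpoly R[k]} := mmap (@mpolyC k R) y.

HB.instance Definition _ (R : comNzRingType) (m k : nat)
    (y : 'I_m -> {mpoly R[k]}) :=
  GRing.RMorphism.copy (msubst y) (mmap (@mpolyC k R) y).

Lemma msubstC (R : comNzRingType) m k (y : 'I_m -> {mpoly R[k]}) c :
  msubst y c%:MP = c%:MP.
Proof. exact: mmapC. Qed.

Lemma msubstX (R : comNzRingType) m k (y : 'I_m -> {mpoly R[k]}) i :
  msubst y 'X_i = y i.
Proof. by rewrite /msubst mmapX mmap1U. Qed.

Lemma msubstZ (R : comNzRingType) m k (y : 'I_m -> {mpoly R[k]}) c p :
  msubst y (c *: p) = c *: msubst y p.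
Proof. by rewrite -!mul_mpolyC rmorphM /= msubstC. Qed.

Lemma meval_msubst (R : comNzRingType) m k (y : 'I_m -> {mpoly R[k]}) p x :
  (msubst y p).@[x] = p.@[fun i => (y i).@[x]].
Proof.
elim/mpoly_ind_ring: p => [c|i|p q IHp IHq|p q IHp IHq].
- by rewrite msubstC !mevalC.
- by rewrite msubstX mevalXU.
- by rewrite rmorphD !mevalD IHp IHq.
- by rewrite rmorphM !mevalM IHp IHq.
Qed.

Lemma msubst_comp (R : comNzRingType) m k l (y : 'I_m -> {mpoly R[k]})
    (z : 'I_k -> {mpoly R[l]}) p :
  msubst z (msubst y p) = msubst (fun i => msubst z (y i)) p.
Proof.
elim/mpoly_ind_ring: p => [c|i|p q IHp IHq|p q IHp IHq].
- by rewrite !msubstC.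
- by rewrite !msubstX.
- by rewrite !rmorphD /= IHp IHq.
- by rewrite !rmorphM /= IHp IHq.
Qed.

Lemma mderiv_msubst (R : comNzRingType) m k (y : 'I_m -> {mpoly R[k]}) p c :
  (msubst y p)^`M(c) = \sum_i msubst y p^`M(i) * (y i)^`M(c).
Proof.
apply: (@derivation_mmap _ _ (@mpolyC k R) _ y (mderiv c)) => [a b|a b|a].
- exact: mderivD.
- exact: mderivM.
- exact: mderivC.
Qed.

(* In characteristic 0 an iterated derivative of a nonzero polynomial is a
   nonzero constant. *)
Lemma mderiv_closed_eq0 (K : numFieldType) m (P : {mpoly K[m]} -> Prop) :
  (forall p, P p -> forall i, P p^`M(i)) -> (forall c, P c%:MP -> c = 0) ->
  forall p, P p -> p = 0.
Proof.
move=> Pd Pc p; have [k] : exists k, forall mm, (k <= mdeg mm)%N -> p@_mm = 0.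
  exists (msize p) => mm; apply: contraTeq; rewrite -mcoeff_msupp -ltnNge.
  exact: msize_mdeg_lt.
elim: k p => [|k IHk] p pk Pp.
  by apply/mpolyP=> mm; rewrite mcoeff0 pk.
have p0 i : p^`M(i) = 0.
  apply: IHk (Pd _ Pp i) => mm kmm.
  by rewrite mcoeff_deriv pk ?mul0rn // mdegD mdeg1 addn1.
have pC : p = (p@_0)%:MP.
  apply/mpolyP=> mm; rewrite mcoeffC; have [->|mm0] := eqVneq mm 0%MM.
    by rewrite mulr1.
  rewrite mulr0; have [i mi0] : exists i, mm i != 0%N.
    apply/existsP; move: mm0; apply: contraNT; rewrite negb_exists.
    move=> /forallP mm0; apply/eqP/mnmP=> i; rewrite mnm0E; apply/eqP.
    by rewrite -[_ == _]negbK mm0.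
  have := congr1 (mcoeff (mm - U_(i))%MM) (p0 i).
  rewrite mcoeff_deriv submK ?lep1mP // mcoeff0 => /eqP.
  by rewrite mulrn_eq0 => /= /eqP.
by rewrite pC in Pp *; rewrite (Pc _ Pp) mpolyC0.
Qed.

Lemma poly_eval_eq0 (K : numFieldType) (p : {poly K}) :
  (forall a, p.[a] = 0) -> p = 0.
Proof.
move=> p0; apply/eqP; apply: contraT => pN0.
have /(max_poly_roots pN0) : all (root p) [seq i%:R | i <- iota 0 (size p)].
  by apply/allP=> a _; apply/eqP.
rewrite map_inj_uniq ?iota_uniq; last exact: (mulrIn (oner_neq0 K)).
by move=> /(_ isT); rewrite size_map size_iota ltnn.
Qed.

(** Vanishing everywhere is inherited by partial derivatives: on the line through [x] in direction
    [i] the polynomial becomes a univariate one having every number as a root. *)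
Lemma mpoly_meval_eq0 (K : numFieldType) m (p : {mpoly K[m]}) :
  (forall x, p.@[x] = 0) -> p = 0.
Proof.
move: p; apply: mderiv_closed_eq0 => [p p0 i x|c /(_ (fun=> 0))]; last first.
  by rewrite mevalC.
pose y (j : 'I_m) : {poly K} := (x j)%:P + (j == i)%:R *: 'X.
have yE a q : (mmap polyC y q).[a] = q.@[fun j => x j + (j == i)%:R * a].
  elim/mpoly_ind_ring: q => [c|j|q r IHq IHr|q r IHq IHr].
  - by rewrite mmapC hornerC mevalC.
  - by rewrite mmapX mmap1U mevalXU /y !hornerE.
  - by rewrite mmapD mevalD hornerD IHq IHr.
  - by rewrite rmorphM mevalM hornerM IHq IHr.
have py0 : mmap polyC y p = 0 by apply: poly_eval_eq0 => a; rewrite yE.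
have := @derivation_mmap _ _ polyC _ y _ p (@derivD K) (@derivM K) (@derivC K).
rewrite py0 deriv0 (bigD1 i) //= big1 => [|j /negbTE ji]; last first.
  by rewrite /y ji scale0r addr0 derivC mulr0.
rewrite addr0 /y eqxx scale1r derivD derivC derivX add0r mulr1.
move=> /(congr1 (fun q => q.[0])); rewrite -/y yE horner0 => /esym.
rewrite (_ : meval _ _ = (p^`M(i)).@[x]) //; apply: meval_eq => j.
by rewrite mulr0 addr0.
Qed.

Lemma mpoly_neq0_meval (K : numFieldType) m (p : {mpoly K[m]}) :
  p != 0 -> exists x, p.@[x] != 0.
Proof.
move=> pN0; apply: contrapT => nx; move/eqP: pN0; apply.
apply: mpoly_meval_eq0 => x; apply/eqP; apply: contrapT => px.
by apply: nx; exists x; apply/negP.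
Qed.

(** This replaces the choice of a relation of minimal degree: if all derivatives of relations were
    relations, iterated differentiation would end in a nonzero constant relation. *)
Lemma algebraic_relation_mderiv (K : numFieldType) m k
    (y : 'I_m -> {mpoly K[k]}) (p : {mpoly K[m]}) :
  p != 0 -> msubst y p = 0 ->
  exists q, msubst y q = 0 /\ exists i, msubst y q^`M(i) != 0.
Proof.
move=> /eqP pN0 py0; apply: contrapT => nq; apply: pN0; move: py0.
apply: (@mderiv_closed_eq0 _ _ (fun p => msubst y p = 0)) => [q qy0 i|c].
  apply/eqP; apply: contrapT => qi; apply: nq; exists q; split=> //.
  by exists i; apply/negP.
by rewrite msubstC => /eqP; rewrite mpolyC_eq0 => /eqP.
Qed.

(** * Algebraic relations by counting monomials *)

Lemma msize_prod_expr (R : idomainType) (I : finType) m (y : I -> {mpoly R[m]})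
    (a : I -> nat) e :
  (forall i, msize (y i) <= e.+1)%N ->
  (msize (\prod_i y i ^+ a i) <= (\sum_i a i * e).+1)%N.
Proof.
move=> ye.
have mulS p q j k : (msize p <= j.+1 -> msize q <= k.+1 ->
    msize (p * q : {mpoly R[m]}) <= (j + k).+1)%N.
  move=> pj qk; have [->|p0] := eqVneq p 0; first by rewrite mul0r msize0.
  have [->|q0] := eqVneq q 0; first by rewrite mulr0 msize0.
  rewrite msizeM //; have := leq_add pj qk; rewrite addSn addnS.
  by case: (_ + _)%N.
elim/big_rec2: _ => [|i x p _ IH]; first by rewrite msize1.
apply: (mulS) => //; elim: (a i) => [|k IHk]; first by rewrite expr0 msize1.
by rewrite exprS mulSn; apply: (mulS).
Qed.

(** The number D = (de+1)^r + 1 is chosen to exceed (de+1)^r, whence (D(de+1))^r < D^(r+1) <=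
    D^d. *)
Lemma exp_counting (d r e : nat) : (r < d)%N ->
  ((((d * e).+1 ^ r).+1 * (d * e)).+1 ^ r < ((d * e).+1 ^ r).+1 ^ d)%N.
Proof.
set D := (((d * e).+1 ^ r).+1)%N => rd; have D0 : (0 < D)%N by [].
apply: (@leq_ltn_trans ((D * (d * e).+1) ^ r)%N).
  have Dde : ((D * (d * e)).+1 <= D * (d * e).+1)%N.
    by rewrite mulnS -add1n leq_add2r.
  have [r0|r0] := posnP r; first by rewrite r0 !expn0.
  by rewrite leq_exp2r.
apply: (@leq_trans (D ^ r.+1)%N); last by rewrite leq_pexp2l.
by rewrite expnMn expnS mulnC ltn_pmul2r // expn_gt0 D0.
Qed.

(* There are [D ^ d] monomials with exponents below [D], but only a multiple of
   [D ^ r] coefficients in their values. *)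
Lemma exists_algebraic_relation (K : fieldType) (d r : nat)
    (y : 'I_d -> {mpoly K[r]}) :
  (r < d)%N -> exists p, p != 0 /\ msubst y p = 0.
Proof.
move=> rd; pose e := \max_i msize (y i).
have ye i : (msize (y i) <= e.+1)%N by rewrite leqW // (leq_bigmax i).
(* There are [D] exponents per variable. The values then have degree at most [B], so columns indexed
   by exponents up to [B] record all their coefficients. *)
pose D := (((d * e).+1 ^ r).+1)%N; pose B := (D * (d * e))%N.
pose rows := {ffun 'I_d -> 'I_D}; pose cols := {ffun 'I_r -> 'I_B.+1}.
pose Q (a : rows) := \prod_i y i ^+ a i.
pose ma (a : rows) : 'X_{1..d} := [multinom (a i : nat) | i < d].
have QE a : msubst y 'X_[ma a] = Q a.
  rewrite mpolyXE_id rmorph_prod; apply: eq_bigr => i _.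
  by rewrite rmorphXn /= msubstX mnmE.
pose A : 'M[K]_(#|rows|, #|cols|) :=
  \matrix_(a, b) (Q (enum_val a))@_[multinom ((enum_val b : cols) i : nat) | i < r].
have /rowV0Pn[u uA u0] : kermx A != 0.
  rewrite kermx_eq0 /row_free; apply: contraTneq (rank_leq_col A) => ->.
  rewrite -ltnNge /rows /cols !card_ffun !card_ord; exact: exp_counting.
move/sub_kermxP: uA => uA.
pose p := \sum_a u 0 a *: 'X_[ma (enum_val a)].
exists p; split.
  case/rV0Pn: u0 => a ua; apply: contraNneq ua => p0.
  have := congr1 (mcoeff (ma (enum_val a))) p0.
  rewrite mcoeff0 /p raddf_sum (bigD1 a) //= big1 => [|b ba].
    by rewrite mcoeffZ mcoeffX eqxx mulr1 addr0 => ->.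
  rewrite mcoeffZ mcoeffX; case: eqP => [/mnmP E|_]; last by rewrite mulr0.
  case/eqP: ba; apply: enum_val_inj; apply/ffunP=> i; apply: val_inj.
  by have := E i; rewrite !mnmE.
have pE : msubst y p = \sum_a u 0 a *: Q (enum_val a).
  by rewrite /p rmorph_sum; apply: eq_bigr => a _; rewrite /= msubstZ QE.
apply/mpolyP=> m; rewrite mcoeff0 pE raddf_sum /=.
have [/forallP mB|] := boolP [forall i, (m i < B.+1)%N]; last first.
  rewrite negb_forall; case/existsP=> i; rewrite -leqNgt => Bm.
  apply: big1 => a _; rewrite mcoeffZ memN_msupp_eq0 ?mulr0 //.
  apply: contraL Bm => /msize_mdeg_lt /leq_trans.
  move=> /(_ _ (msize_prod_expr (fun i => (enum_val a : rows) i : nat) ye)) mS.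
  rewrite -ltnNge ltnS (@leq_trans (mdeg m)) //.
    by rewrite mdegE (bigD1 i) //= leq_addr.
  move: mS; rewrite ltnS => /leq_trans; apply.
  rewrite -big_distrl /= /B mulnA leq_mul2r orbC.
  rewrite (leq_trans (n := \sum_(i < d) D)%N) //.
    by apply: leq_sum => j _; apply: ltnW.
  by rewrite sum_nat_const card_ord mulnC.
pose b : cols := [ffun i => Ordinal (mB i)].
have := congr1 (fun M : 'rV_ _ => M 0 (enum_rank b)) uA; rewrite !mxE => uAb.
rewrite -[RHS]uAb; apply: eq_bigr => a _; rewrite mcoeffZ mxE enum_rankK.
by congr (_ * _@_ _); apply/mnmP=> i; rewrite mnmE ffunE.
Qed.

(** * Minors and the Jacobian criterion for algebraic dependence *)

Lemma mxminor_rank (K : fieldType) m n (A : 'M[K]_(m, n)) :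
  exists (f : 'I_(\rank A) -> 'I_m) (g : 'I_(\rank A) -> 'I_n),
    [/\ injective f, injective g & \det (mxsub f g A) != 0].
Proof.
have free := maxrowsub_free A; set B := rowsub _ A in free.
have full : row_full B^T by rewrite /row_full mxrank_tr.
exists (maxrankfun A), (fullrankfun full); split.
- exact: maxrankfun_inj.
- exact: fullrankfun_inj.
- have := fullrowsub_full full; rewrite row_full_unit -unitmx_tr unitmxE unitfE.
  rewrite (_ : (rowsub _ _)^T = mxsub (maxrankfun A) (fullrankfun full) A) //.
  by apply/matrixP=> i j; rewrite !mxE.
Qed.

Lemma rank_ge_minor (K : fieldType) m n r (A : 'M[K]_(m, n))
    (f : 'I_r -> 'I_m) (g : 'I_r -> 'I_n) :
  \det (mxsub f g A) != 0 -> (r <= \rank A)%N.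
Proof.
rewrite -unitfE -unitmxE => /mxrank_unit {1}<-.
rewrite (_ : mxsub f g A = rowsub f (A *m (rowsub g 1%:M)^T)); last first.
  apply/matrixP=> i j; rewrite !mxE (bigD1 (g j)) //= !mxE eqxx mulr1 big1.
    by rewrite addr0.
  by move=> k kj; rewrite !mxE eq_sym (negbTE kj) mulr0.
exact: leq_trans (mxrankS (rowsub_sub _ _)) (mxrankM_maxl _ _).
Qed.

(** Cramer's rule multiplied by the determinant: free of inverses, it can be transferred from the
    values of a polynomial matrix to the matrix itself. *)
Lemma minor_factorization (K : fieldType) m n r (A : 'M[K]_(m, n))
    (f : 'I_r -> 'I_m) (g : 'I_r -> 'I_n) :
  (\rank A <= r)%N -> \det (mxsub f g A) != 0 ->
  \det (mxsub f g A) *: A = colsub g A *m \adj (mxsub f g A) *m rowsub f A.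
Proof.
move=> rA dA.
have rf : (r <= \rank (rowsub f A))%N.
  apply: (@rank_ge_minor _ _ _ _ _ id g).
  by rewrite (_ : mxsub id g _ = mxsub f g A) //; apply/matrixP=> i j; rewrite !mxE.
have /submxP[X AX] : (A <= rowsub f A)%MS.
  have /leqifP := mxrank_leqif_sup (rowsub_sub f A); case: ifP => // _.
  by rewrite ltnNge (leq_trans rA rf).
rewrite [in colsub g A]AX -mulmx_colsub -mxsubcr.
by rewrite -(mulmxA X) mul_mx_adj -mulmxA mul_scalar_mx -scalemxAr -AX.
Qed.

(** Rows are indexed by variables, the transpose of the usual convention: at a point, the row space
    is the image of the differential. *)
Definition jacobian (R : comNzRingType) N d (y : 'I_d -> {mpoly R[N]}) :
  'M[{mpoly R[N]}]_(N, d) := \matrix_(c, j) (y j)^`M(c).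

Definition jacobian_at (R : comNzRingType) N d (y : 'I_d -> {mpoly R[N]})
  (x : 'I_N -> R) : 'M[R]_(N, d) := map_mx (meval x) (jacobian y).

Lemma jacobian_max (K : fieldType) N d (y : 'I_d -> {mpoly K[N]}) :
  exists r, (forall x, \rank (jacobian_at y x) <= r)%N /\
            exists x, \rank (jacobian_at y x) = r.
Proof.
have ex : exists r, `[< exists x, \rank (jacobian_at y x) = r >].
  by exists (\rank (jacobian_at y (fun=> 0))); apply/asboolP; exists (fun=> 0).
have ub r : `[< exists x, \rank (jacobian_at y x) = r >] -> (r <= N)%N.
  by move=> /asboolP[x <-]; apply: rank_leq_row.
case: (ex_maxnP ex ub) => r /asboolP rx rmax; exists r; split=> // x.
by apply: rmax; apply/asboolP; exists x.
Qed.

(* Shows by induction on [k] that [F] vanishes to every order along the slice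
   [s]: its derivatives transversal to the slice are combinations of the
   tangential ones. *)
Lemma slice_vanishing (K : numFieldType) N r (C : 'I_r -> 'I_N)
    (s : 'I_N -> {mpoly K[r]}) (D F : {mpoly K[N]})
    (B : 'I_N -> 'I_r -> {mpoly K[N]}) :
  (forall c k, (s c)^`M(k) = (c == C k)%:R) -> msubst s D != 0 ->
  (forall c, D * F^`M(c) = \sum_k B c k * F^`M(C k)) ->
  msubst s F = 0 -> F = 0.
Proof.
move=> ds D0 eqF F0.
(* [van k G]: all derivatives of [G] of order at most [k] vanish on the slice. *)
pose van := fix van k G := msubst s G = 0 /\
  if k is k'.+1 then forall c, van k' G^`M(c) else True.
have van0 k G : van k G -> msubst s G = 0 by case: k => [|k] [].
have vanW k G : van k.+1 G -> van k G.
  elim: k G => [|k IHk] G [G0 dG]; split=> // c.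
  by apply: IHk; apply: dG.
have vanD k G H : van k G -> van k H -> van k (G + H).
  elim: k G H => [|k IHk] G H [G0 dG] [H0 dH].
    by split=> //; rewrite rmorphD /= G0 H0 addr0.
  split; first by rewrite rmorphD /= G0 H0 addr0.
  move=> c; rewrite (mderivD c G H); apply: IHk; first exact: dG. exact: dH.
have vanM k A G : van k G -> van k (A * G).
  elim: k A G => [|k IHk] A G vG; have G0 := van0 _ _ vG.
    by split=> //; rewrite rmorphM /= G0 mulr0.
  split=> [|c]; first by rewrite rmorphM /= G0 mulr0.
  rewrite mderivM; apply: vanD; apply: IHk; first exact: (vanW _ _ vG).
  by case: vG => _; apply.
have van_sum k I (u : seq I) (G : I -> {mpoly K[N]}) :
    (forall i, van k (G i)) -> van k (\sum_(i <- u) G i).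
  move=> vG; elim/big_ind: _ => //; last by move=> *; apply: vanD.
  elim: k {vG} => [|k IHk]; split; rewrite ?rmorph0 //.
  by move=> c; rewrite mderiv0.
(* Along the coordinates of the slice no order is lost, because these derivatives commute with
   restriction. *)
have van_tangent k l G : van k G -> van k G^`M(C l).
  elim: k G => [|k IHk] G [G0 dG].
    split=> //; have := mderiv_msubst s G l; rewrite G0 mderiv0 (bigD1 (C l)) //=.
    rewrite big1 => [|c cl]; last by rewrite ds (negbTE cl) mulr0.
    by rewrite ds eqxx mulr1 addr0.
  split=> [|c].
    have := mderiv_msubst s G l; rewrite G0 mderiv0 (bigD1 (C l)) //=.
    rewrite big1 => [|c cl]; last by rewrite ds (negbTE cl) mulr0.
    by rewrite ds eqxx mulr1 addr0.
  rewrite mderiv_comm; apply: IHk; exact: dG.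
(* Leibniz's rule gives D dG = d(DG) - (dD) G, and [G] vanishes to the lower order by induction. *)
have van_cancel k G : van k (D * G) -> van k G.
  have c0 G' : msubst s (D * G') = 0 -> msubst s G' = 0.
    by rewrite rmorphM /= => /eqP; rewrite mulf_eq0 (negbTE D0) => /eqP.
  elim: k G => [|k IHk] G vDG; have G0 := c0 _ (van0 _ _ vDG); split=> // c.
  have vG := IHk _ (vanW _ _ vDG); apply: IHk.
  rewrite (_ : D * _ = (D * G)^`M(c) + - D^`M(c) * G).
    apply: vanD; [by case: vDG => _; apply | exact: vanM].
  by rewrite mderivM mulNr addrC addrA addNr add0r.
have vanF k : van k F.
  elim: k => [|k IHk]; split=> // c.
  apply: van_cancel; rewrite eqF; apply: van_sum => l; apply: vanM.
  exact: van_tangent.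
move: F vanF {eqF F0}.
apply: (@mderiv_closed_eq0 _ _ (fun G => forall k, van k G)) => [G vG i k|c vc].
  by case: (vG k.+1) => _; apply.
by have := van0 0%N _ (vc 0%N); rewrite msubstC => /eqP; rewrite mpolyC_eq0 => /eqP.
Qed.

Lemma jacobian_relation (K : numFieldType) N d (y : 'I_d -> {mpoly K[N]}) :
  (forall x, \rank (jacobian_at y x) < d)%N ->
  exists p, p != 0 /\ msubst y p = 0.
Proof.
move=> rd; have [r [rmax [x0 rx0]]] := jacobian_max y.
have [C [R [Cinj _ dx0]]] := mxminor_rank (jacobian_at y x0).
rewrite rx0 in C R Cinj dx0.
pose M := mxsub C R (jacobian y); pose D := \det M.
have DE x : D.@[x] = \det (mxsub C R (jacobian_at y x)).
  by rewrite /D -det_map_mx map_mxsub.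
(* The slice through [x0] along the coordinates [C]; the other coordinates are frozen at their
   values in [x0]. *)
pose s c : {mpoly K[r]} :=
  if [pick k | C k == c] is Some k then 'X_k else (x0 c)%:MP.
have sC k : s (C k) = 'X_k.
  by rewrite /s; case: pickP => [l /eqP/Cinj-> // | /(_ k)]; rewrite eqxx.
have ds c k : (s c)^`M(k) = (c == C k)%:R.
  have [->|cC] := eqVneq c (C k).
    by rewrite sC mderivXU eqxx.
  rewrite /s; case: pickP => [l /eqP lc|_]; last by rewrite mderivC.
  rewrite mderivXU; case: eqP => [lk|//].
  by case/eqP: cC; rewrite -lc lk.
have sD : msubst s D != 0.
  apply: contraNneq dx0 => sD; rewrite -DE.
  have := congr1 (meval (fun k => x0 (C k))) sD; rewrite meval_msubst meval0.
  move=> <-; apply/eqP; apply: meval_eq => c; rewrite /s.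
  by case: pickP => [k /eqP <-|_]; rewrite ?mevalXU ?mevalC.
(* Where [D] is nonzero this is [minor_factorization], as the rank never exceeds [r]. After
   multiplication by [D] it holds at every point, hence for polynomials, and [D] is cancelled. *)
have fact : D *: jacobian y =
    colsub R (jacobian y) *m \adj M *m rowsub C (jacobian y).
  apply/matrixP=> c j; apply/eqP; rewrite -subr_eq0.
  have /eqP : D * ((D *: jacobian y) c j -
      (colsub R (jacobian y) *m \adj M *m rowsub C (jacobian y)) c j) = 0.
    apply: mpoly_meval_eq0 => x; rewrite mevalM.
    have [->|dx] := eqVneq D.@[x] 0; first by rewrite mul0r.
    rewrite DE in dx; have := minor_factorization (rmax x) dx.
    rewrite -DE -!map_mxsub -map_mx_adj -!map_mxM -map_mxZ.
    by move=> /matrixP/(_ c j); rewrite !mxE mevalB => ->; rewrite subrr mulr0.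
  rewrite mulf_eq0 => /orP[/eqP D0|//].
  by move: sD; rewrite D0 rmorph0 eqxx.
have r_lt_d : (r < d)%N by rewrite -rx0.
have [p [p0 yp]] := exists_algebraic_relation (fun j => msubst s (y j)) r_lt_d.
exists p; split=> //.
(* Through the chain rule, the factorization writes [D] times any derivative of [msubst y p] as a
   combination of the derivatives along [C]. *)
pose B := colsub R (jacobian y) *m \adj M.
apply: (slice_vanishing (B := fun c k => B c k) ds sD).
  move=> c; rewrite mderiv_msubst mulr_sumr.
  under eq_bigr => j _.
    have := congr1 (fun A : 'M_(_, _) => A c j) fact; rewrite !mxE => fj.
    rewrite mulrCA fj mulr_sumr; over.
  rewrite exchange_big; apply: eq_bigr => k _ /=.
  rewrite mderiv_msubst mulr_sumr; apply: eq_bigr => j _.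
  by rewrite [rowsub _ _ _ _]mxE [jacobian _ _ _]mxE mulrCA.
by rewrite msubst_comp.
Qed.

(** * Tangent spaces of parametrized varieties *)

Lemma rank_jacobian_index (K : fieldType) N M d (y : 'I_M -> {mpoly K[N]})
    (u : 'I_d -> 'I_M) x :
  (\rank (jacobian_at (fun j => y (u j)) x) <= \rank (jacobian_at y x))%N.
Proof.
rewrite -mxrank_tr -[leqRHS]mxrank_tr.
rewrite (_ : _^T = rowsub u (jacobian_at y x)^T); last first.
  by apply/matrixP=> i j; rewrite !mxE.
by rewrite mxrankS // rowsub_sub.
Qed.

Lemma rank_jacobian_msubst (K : fieldType) N M d (y : 'I_M -> {mpoly K[N]})
    (f : 'I_d -> {mpoly K[M]}) x :
  (\rank (jacobian_at (fun j => msubst y (f j)) x) <= \rank (jacobian_at y x))%N.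
Proof.
rewrite (_ : jacobian_at _ x = jacobian_at y x *m
    \matrix_(i, j) (msubst y (f j)^`M(i)).@[x]); first exact: mxrankM_maxl.
apply/matrixP=> c j; rewrite !mxE mderiv_msubst raddf_sum /=.
by apply: eq_bigr => i _; rewrite !mxE mevalM mulrC.
Qed.

Lemma minor_kernel (R : idomainType) N M r (A : 'M[R]_(N, M))
    (C : 'I_r -> 'I_N) (T : 'I_r -> 'I_M) (v : 'I_r -> R) :
  \det (mxsub C T A) != 0 ->
  (forall c, \sum_k A c (T k) * v k = 0) -> forall k, v k = 0.
Proof.
move=> dA Av k; have : mxsub C T A *m \col_k v k = 0.
  apply/matrixP=> l j; rewrite !mxE -[RHS](Av (C l)).
  by apply: eq_bigr => i _; rewrite !mxE.
move=> /(congr1 (mulmx (\adj (mxsub C T A)))).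
rewrite mulmxA mul_adj_mx mul_scalar_mx mulmx0 => /matrixP/(_ k 0).
by rewrite !mxE => /eqP; rewrite mulf_eq0 (negbTE dA) => /eqP.
Qed.

Lemma det_jacobian_neq0 (R : comNzRingType) N M r (y : 'I_M -> {mpoly R[N]})
    (C : 'I_r -> 'I_N) (T : 'I_r -> 'I_M) x :
  \det (mxsub C T (jacobian_at y x)) != 0 ->
  \det (mxsub C T (jacobian y)) != 0.
Proof.
by apply: contraNneq => d0; rewrite -map_mxsub det_map_mx d0 rmorph0.
Qed.

(** Converse to [jacobian_relation]: differentiating a relation whose derivatives are not all
    relations gives a nonzero kernel vector of an invertible minor. *)
Lemma jacobian_independent (K : numFieldType) N M r (y : 'I_M -> {mpoly K[N]})
    (C : 'I_r -> 'I_N) (T : 'I_r -> 'I_M) (p : {mpoly K[r]}) :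
  \det (mxsub C T (jacobian y)) != 0 ->
  msubst (fun k => y (T k)) p = 0 -> p = 0.
Proof.
move=> dJ yp; apply/eqP; apply: contraT => p0.
have [q [yq [i qi]]] := algebraic_relation_mderiv p0 yp.
move: qi; rewrite (minor_kernel (v := fun k => msubst (fun k => y (T k)) q^`M(k)) dJ).
  by rewrite eqxx.
move=> c; transitivity (msubst (fun k => y (T k)) q)^`M(c).
  by rewrite mderiv_msubst; apply: eq_bigr => k _; rewrite mxE mulrC.
by rewrite yq mderiv0.
Qed.

(* At a general point of the image closure the Zariski tangent space has
   dimension at most the rank of the Jacobian: each coordinate satisfies a
   separable relation over the coordinates picked out by [T]. *)
Lemma tangent_bound (K : numFieldType) N M r (y : 'I_M -> {mpoly K[N]})
    (C : 'I_r -> 'I_N) (T : 'I_r -> 'I_M) :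
  (forall x, \rank (jacobian_at y x) <= r)%N ->
  \det (mxsub C T (jacobian y)) != 0 ->
  exists h : {mpoly K[M]}, msubst y h != 0 /\
    forall q w : 'I_M -> K, h.@[q] != 0 ->
      (forall f, msubst y f = 0 -> \sum_m f^`M(m).@[q] * w m = 0) ->
      (forall k, w (T k) = 0) -> forall m, w m = 0.
Proof.
(* The coordinates [T] followed by coordinate [m] in the last place: [r.+1] functions whose Jacobian
   has rank at most [r]. *)
move=> rmax dJ; pose u m j := oapp T m (unlift (@ord_max r) j).
have uT m k : u m (lift ord_max k) = T k by rewrite /u liftK.
have uM m : u m ord_max = m by rewrite /u unlift_none.
have rel m : exists q : {mpoly K[r.+1]},
    msubst (fun j => y (u m j)) q = 0 /\
    msubst (fun j => y (u m j)) q^`M(ord_max) != 0.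
  have [x|p [p0 yp]] := @jacobian_relation _ _ _ (fun j => y (u m j)).
    by rewrite ltnS (leq_trans (rank_jacobian_index _ _ _)).
  have [q [yq [i qi]]] := algebraic_relation_mderiv p0 yp.
  exists q; split; first exact: yq.
  (* Otherwise the derivatives in the first [r] variables would form a kernel vector of the
     invertible minor, so that all derivatives of [q] would be relations. *)
  apply: contraNneq qi => qmax.
  pose v k := msubst (fun j => y (u m j)) q^`M(lift ord_max k).
  case: (unliftP ord_max i) => [k ->|-> //]; last by rewrite qmax.
  apply/eqP; apply: (minor_kernel (v := v) dJ) => c.
  have := mderiv_msubst (fun j => y (u m j)) q c.
  rewrite yq mderiv0 (bigD1_ord ord_max) //= qmax mul0r add0r => rel0; rewrite [RHS]rel0.
  by apply: eq_bigr => l _; rewrite mxE mulrC uT.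
have [q qP] := choice rel.
have yu m : (fun j => msubst y 'X_(u m j)) = (fun j => y (u m j)).
  by apply/funext => j; rewrite msubstX.
(* Where [h] is nonzero, the differential of the relation for [m] has a nonzero coefficient at
   [w m], so zeros at [T] force [w m = 0]. *)
exists (\prod_m msubst (fun j => 'X_(u m j)) (q m)^`M(ord_max)); split.
  rewrite rmorph_prod; apply/prodf_neq0 => m _; rewrite /= msubst_comp.
  by rewrite yu; case: (qP m).
move=> x w hx tan wT m.
have := tan (msubst (fun j => 'X_(u m j)) (q m)).
rewrite msubst_comp yu => /(_ (qP m).1).
under eq_bigr => l _.
  rewrite mderiv_msubst raddf_sum mulr_suml /=; under eq_bigr => j _.
    rewrite mevalM mderivXU -mulrA; over.
  over.
rewrite exchange_big (bigD1_ord ord_max) //= [X in _ + X]big1 ?addr0 => [|k _].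
  rewrite (bigD1 m) //= big1 ?addr0 => [|l lm]; last first.
    by rewrite uM (negbTE (_ : m != l)) 1?eq_sym // meval0 mul0r mulr0.
  rewrite uM eqxx meval1 mul1r => /eqP; rewrite mulf_eq0 => /orP[|/eqP //].
  by move: hx; rewrite rmorph_prod /= => /prodf_neq0/(_ m isT)/negbTE ->.
apply: big1 => l _; rewrite uT; case: (T k =P l) => [<-|_].
  by rewrite wT !mulr0.
by rewrite meval0 mul0r mulr0.
Qed.

(** * Alternating tensors and Schur modules *)

Section Tensors.

Variables (K : fieldType) (n : nat) (D : seq (nat * nat)).
Implicit Types (t u : tens K n D) (f k : filling n D) (g h : 'M[K]_n).

Lemma tensD t u f : (t + u) f = t f + u f.
Proof. by rewrite ffunE. Qed.

Lemma tensZ c t f : (c *: t) f = c * t f.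
Proof. by rewrite ffunE. Qed.

Lemma act_linear g : linear (@act K n D g).
Proof.
move=> c t u; apply/ffunP=> f; rewrite !ffunE scaler_sumr -big_split.
apply: eq_bigr => k _; rewrite !ffunE mulrDr; congr (_ + _); exact: mulrCA.
Qed.

HB.instance Definition _ g :=
  GRing.isLinear.Build K (tens K n D) (tens K n D) *:%R (@act K n D g)
    (act_linear g).

Lemma act_mul g h t : act (g *m h) t = act g (act h t).
Proof.
apply/ffunP=> f; rewrite !ffunE.
under eq_bigr => k _.
  under eq_bigr => x _ do rewrite mxE.
  rewrite bigA_distr_bigA /= mulr_suml.
  under eq_bigr => j _ do rewrite big_split -mulrA.
  over.
rewrite exchange_big; apply: eq_bigr => j _; rewrite ffunE mulr_sumr.
by apply: eq_bigr.
Qed.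

Lemma act1 t : act 1%:M t = t.
Proof.
apply/ffunP=> f; rewrite ffunE (bigD1 f) //= [X in _ + X]big1 => [|k kf].
  by rewrite addr0 big1 ?mul1r // => x _; rewrite mxE eqxx.
rewrite [X in X * _](_ : _ = 0) ?mul0r //; apply/eqP/prodf_eq0.
have [x fx] : exists x, f x != k x.
  apply/existsP; move: kf; apply: contraNT; rewrite negb_exists => /forallP fk.
  by apply/eqP/ffunP=> x; apply/eqP; rewrite eq_sym -[_ == _]negbK fk.
by exists x; rewrite // mxE (negbTE fx).
Qed.

Lemma actK g : g \in unitmx -> cancel (@act K n D g) (act (invmx g)).
Proof. by move=> gU t; rewrite -act_mul mulVmx // act1. Qed.

Definition dot t u : K := \sum_f t f * u f.

Lemma dotC t u : dot t u = dot u t.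
Proof. by apply: eq_bigr => f _; rewrite mulrC. Qed.

Lemma dot_linear t : linear_for *%R (dot t).
Proof.
move=> c u v; rewrite /dot mulr_sumr -big_split; apply: eq_bigr => f _.
rewrite !ffunE mulrDr; congr (_ + _); exact: mulrCA.
Qed.

HB.instance Definition _ t :=
  GRing.isLinear.Build K (tens K n D) K *%R (dot t) (dot_linear t).

Lemma dot_linearl u c t t' : dot (c *: t + t') u = c * dot t u + dot t' u.
Proof. by rewrite !(dotC _ u) linearP. Qed.

Lemma dot_act g t u : dot (act g t) u = dot t (act g^T u).
Proof.
rewrite /dot; under eq_bigr => f _ do rewrite ffunE mulr_suml.
rewrite exchange_big; apply: eq_bigr => k _; rewrite ffunE mulr_sumr.
apply: eq_bigr => f _; rewrite mulrAC mulrC mulrA mulrAC -mulrA; congr (_ * _).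
by rewrite mulrC; congr (_ * _); apply: eq_bigr => x _; rewrite mxE.
Qed.

Lemma dot_act_dual g t u : g \in unitmx ->
  dot (act_dual g t) (act g u) = dot t u.
Proof. by move=> gU; rewrite /act_dual dot_act trmxK actK. Qed.

Definition lie (xi : 'M[K]_n) t : tens K n D :=
  [ffun f : filling n D => \sum_x \sum_j
     xi (f x) j * t [ffun z => if z == x then j else f z]].

Lemma lie_linear xi : linear (lie xi).
Proof.
move=> c t u; apply/ffunP=> f; rewrite !ffunE scaler_sumr -big_split.
apply: eq_bigr => x _; rewrite scaler_sumr -big_split; apply: eq_bigr => j _.
rewrite !ffunE mulrDr; congr (_ + _); exact: mulrCA.
Qed.

HB.instance Definition _ xi :=
  GRing.isLinear.Build K (tens K n D) (tens K n D) *:%R (lie xi) (lie_linear xi).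

Lemma lie_linearl c xi eta t : lie (c *: xi + eta) t = c *: lie xi t + lie eta t.
Proof.
apply/ffunP=> f; rewrite !ffunE scaler_sumr -big_split.
apply: eq_bigr => x _; rewrite scaler_sumr -big_split; apply: eq_bigr => j _.
rewrite !mxE mulrDl; congr (_ + _); exact/esym/mulrA.
Qed.

Lemma lie_sum_delta xi t :
  lie xi t = \sum_i \sum_j xi i j *: lie (delta_mx i j) t.
Proof.
have lin : linear (lie^~ t) by move=> c a b; apply: lie_linearl.
pose l : {linear 'M[K]_n -> tens K n D} :=
  HB.pack (lie^~ t) (GRing.isLinear.Build K 'M[K]_n (tens K n D) *:%R _ lin).
rewrite {1}[xi]matrix_sum_delta -[LHS]/(l _) linear_sum; apply: eq_bigr => i _.
by rewrite linear_sum; apply: eq_bigr => j _; rewrite linearZ.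
Qed.

(* Swapping the values of a filling and the summation index at the cell [x] is
   an involution, and transposes the action. *)
Lemma dot_lie_dual xi t u : dot (lie_dual xi t) u = - dot t (lie xi u).
Proof.
pose sub f x j : filling n D := [ffun z => if z == x then j else f z].
pose T x (p : filling n D * 'I_n) := xi p.2 (p.1 x) * t (sub p.1 x p.2) * u p.1.
transitivity (- \sum_x \sum_p T x p).
  under eq_bigr => x _ do rewrite -(pair_bigA _ (fun f j => T x (f, j))) /=.
  rewrite exchange_big -sumrN; apply: eq_bigr => f _ /=.
  rewrite ffunE mulNr mulr_suml; congr (- _); apply: eq_bigr => x _.
  by rewrite mulr_suml.
transitivity (- \sum_x \sum_p T x (sub p.1 x p.2, p.1 x)).
  congr (- _); apply: eq_bigr => x _; apply: reindex_inj => -[f j] [g k] /= [/ffunP E fg].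
  have jk : j = k by have := E x; rewrite !ffunE eqxx.
  congr (_, _) => //; apply/ffunP=> z; have [->//|zx] := eqVneq z x.
  by have := E z; rewrite !ffunE (negbTE zx).
under eq_bigr => x _ do
  rewrite -(pair_bigA _ (fun f j => T x (sub f x j, f x))) /=.
rewrite exchange_big; congr (- _); apply: eq_bigr => f _ /=.
rewrite ffunE mulr_sumr; apply: eq_bigr => x _; rewrite mulr_sumr.
apply: eq_bigr => j _; rewrite /T /= [sub f x j x]ffunE eqxx.
rewrite (_ : sub (sub f x j) x (f x) = f) ?[_ * t f]mulrC ?mulrA //.
by apply/ffunP=> z; rewrite !ffunE; case: eqP => [->|].
Qed.

End Tensors.

(** Since [B] is an initial segment, the elements of [A :\: B] exceed those of [B :\: A], of which
    there are equally many; each exchange costs at least 1. *)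
Lemma sum_initial_segment n (A B : {set 'I_n}) :
  #|A| = #|B| -> (forall a b : 'I_n, b \in B -> a <= b -> a \in B)%N ->
  (\sum_(b in B) b + #|A :\: B| <= \sum_(a in A) a)%N.
Proof.
move=> cAB Bdown; rewrite (big_setID A) [leqRHS](big_setID B) /= finset.setIC -addnA.
rewrite leq_add2l; have cD : #|B :\: A| = #|A :\: B|.
  by apply/eqP; rewrite -(eqn_add2l #|A :&: B|) {1}finset.setIC !cardsID cAB.
have [E|[a0 a0AB]] := set_0Vmem (A :\: B).
  rewrite E.
  rewrite cards0 addn0 big_pred0 // => b; apply/negbTE.
  suff -> : B :\: A = finset.set0 by rewrite finset.in_set0.
  by apply/eqP; rewrite -cards_eq0 cD E cards0.
case: (arg_minnP (fun a : 'I_n => a : nat) a0AB) => a1 a1AB a1min.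
rewrite -cD -sum1_card -big_split /=.
apply: (@leq_trans (\sum_(b in B :\: A) a1)%N).
  apply: leq_sum => b /finset.setDP[bB bA]; rewrite addn1 ltnNge.
  apply: contra bA => a1b; case/finset.setDP: a1AB => a1A.
  by rewrite (Bdown _ b).
by rewrite sum_nat_const cD -sum_nat_const; apply: leq_sum.
Qed.

(** * Fillings with distinct entries in each column *)

Section Columns.

Variables (n : nat) (D : seq (nat * nat)).
Hypothesis D_up : forall r c r', (r, c) \in D -> (r' <= r)%N -> (r', c) \in D.
Hypothesis D_rows : forall r c, (r, c) \in D -> (r < n)%N.

Implicit Types (f k : filling n D) (x y z : seq_sub D).

Lemma cell_row_lt x : ((val x).1 < n)%N.
Proof. by apply: (@D_rows _ (val x).2); rewrite -surjective_pairing; apply: valP. Qed.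

Definition row_filling : filling n D := [ffun x => Ordinal (cell_row_lt x)].

Definition col_injective f :=
  forall x y, (val x).2 = (val y).2 -> f x = f y -> x = y.

Lemma row_filling_inj : col_injective row_filling.
Proof.
move=> x y cxy; rewrite !ffunE => /(congr1 val) /= rxy; apply: val_inj.
by rewrite [LHS]surjective_pairing [RHS]surjective_pairing rxy cxy.
Qed.

Definition column_preserving (s : {perm seq_sub D}) :=
  [forall x, (val (s x)).2 == (val x).2].

Definition fill_perm f (s : {perm seq_sub D}) : filling n D :=
  [ffun x => f (s x)].

(** The matrix diag(1, 2, 4, ...) scales the basis tensor of [f] by 2 to this power. Small sums
    correspond to high weights for the upper triangular Borel subgroup. *)
Definition weight f : nat := \sum_x f x.

Lemma weight_perm f s : weight (fill_perm f s) = weight f.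
Proof.
rewrite /weight [RHS](reindex_inj (@perm_inj _ s)) /=.
by apply: eq_bigr => x _; rewrite ffunE.
Qed.

Lemma fill_perm_row_inj s s' : column_preserving s -> column_preserving s' ->
  fill_perm row_filling s = fill_perm row_filling s' -> s = s'.
Proof.
move=> /forallP cs /forallP cs' /ffunP E; apply/permP=> x.
apply: row_filling_inj; first by rewrite (eqP (cs x)) (eqP (cs' x)).
by have := E x; rewrite [LHS]ffunE [RHS]ffunE.
Qed.

(** Distinct entries in a column add up to at least the sum of an initial segment, and the excess
    bounds the number of entries outside it. A total that is no larger leaves no excess in any
    column. *)
Lemma low_filling f : col_injective f -> (weight f <= weight row_filling)%N ->
  exists2 s : {perm seq_sub D}, column_preserving s & f = fill_perm row_filling s.
Proof.
move=> finj low; pose b := \max_(x : seq_sub D) (val x).2.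
pose col (x : seq_sub D) : 'I_b.+1 := inord (val x).2.
have colE x y : (col x == col y) = ((val x).2 == (val y).2).
  by rewrite -val_eqE /= !inordK // ltnS leq_bigmax.
have cinj (g : filling n D) c :
    col_injective g -> {in [set x | col x == c] &, injective g}.
  move=> ginj x y; rewrite !finset.inE => /eqP cx /eqP cy; apply: ginj.
  by apply/eqP; rewrite -colE cx cy.
have sumc (g : filling n D) c : col_injective g ->
    (\sum_(x | col x == c) g x = \sum_(a in g @: [set x | col x == c]) a)%N.
  move=> ginj; rewrite big_imset /=; last exact: cinj.
  by apply: eq_bigl => x; rewrite finset.inE.
pose im (g : filling n D) c := g @: [set x | col x == c].
have step c : (\sum_(x | col x == c) row_filling x + #|im f c :\: im row_filling c|
    <= \sum_(x | col x == c) f x)%N.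
  rewrite !sumc //; last exact: row_filling_inj.
  apply: sum_initial_segment.
    rewrite !card_in_imset //; apply: cinj => //; exact: row_filling_inj.
  move=> a r /imsetP[x] /[!finset.inE] /eqP xc -> ar.
  have ax : (val a, (val x).2) \in D.
    apply: (@D_up (val x).1); first by rewrite -surjective_pairing; apply: valP.
    by move: ar; rewrite ffunE.
  apply/imsetP; exists (SeqSub ax); first by rewrite finset.inE -xc colE.
  by apply/val_inj; rewrite ffunE.
have sub c : im f c \subset im row_filling c.
  rewrite -finset.setD_eq0 -cards_eq0 -leqn0.
  move: low; rewrite /weight (partition_big col predT) //=.
  rewrite [leqRHS](partition_big col predT) //= (bigD1 c) //= [leqRHS](bigD1 c) //=.
  have : (\sum_(i < b.+1 | i != c) \sum_(x | col x == i) row_filling x <=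
          \sum_(i < b.+1 | i != c) \sum_(x | col x == i) f x)%N.
    by apply: leq_sum => i _; apply: leq_trans (step i); rewrite leq_addr.
  have := step c => H1 H2 H3; have := leq_trans (leq_add H1 H2) H3.
  by rewrite addnAC -[leqRHS]addn0 leq_add2l.
have cell x : exists y, (val y).2 = (val x).2 /\ row_filling y = f x.
  have : f x \in im row_filling (col x).
    have xf : f x \in im f (col x) by apply: imset_f; rewrite finset.inE.
    exact: (fintype.subsetP (sub (col x)) _ xf).
  case/imsetP=> y; rewrite finset.inE colE => /eqP cy fy.
  by exists y.
have [s sP] := choice cell.
have s_inj : injective s.
  move=> x y sxy; apply: finj.
    by rewrite -(sP x).1 -(sP y).1 sxy.
  by rewrite -(sP x).2 -(sP y).2 sxy.
exists (perm s_inj); first by apply/forallP=> x; rewrite permE (sP x).1.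
by apply/ffunP=> x; rewrite ffunE permE (sP x).2.
Qed.

End Columns.

(** * Alternating tensors and the extremal weight space *)

Section AlternatingTensors.

Variables (K : numFieldType) (n : nat) (D : seq (nat * nat)).
Hypothesis D_up : forall r c r', (r, c) \in D -> (r' <= r)%N -> (r', c) \in D.
Hypothesis D_rows : forall r c, (r, c) \in D -> (r < n)%N.

Implicit Types (t u : tens K n D) (f k : filling n D).

Let f0 := row_filling D_rows.

Lemma fill_perm_tperm f (s : {perm seq_sub D}) (x y : seq_sub D) :
  [ffun z => fill_perm f s (tperm x y z)] = fill_perm f (tperm x y * s)%g.
Proof. by apply/ffunP=> z; rewrite !ffunE permM. Qed.

Lemma alternating_col_injective t f :
  column_alternating t -> t f != 0 -> col_injective f.
Proof.
move=> alt tf x y cxy fxy; apply/eqP; apply: contraNT tf => xy.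
have := alt f x y xy cxy.
rewrite (_ : [ffun z => f (tperm x y z)] = f); last first.
  by apply/ffunP=> z; rewrite ffunE; case: tpermP => [->|->|].
by move/eqP; rewrite -subr_eq0 opprK -mulr2n mulrn_eq0.
Qed.

Lemma alternating_perm t f (s : {perm seq_sub D}) :
  column_alternating t -> column_preserving s -> t (fill_perm f s) = (-1) ^+ s * t f.
Proof.
move=> alt; have [m] := ubnP #|[set x | s x != x]|.
elim: m s => // m IHm s sm cs.
have [s1|] := eqVneq s 1%g.
  rewrite s1 odd_perm1 mul1r; congr (t _); apply/ffunP=> x.
  by rewrite ffunE perm1.
move=> /eqP s1; have [x /eqP sx] : exists x, s x <> x.
  apply: contrapT => nx; apply: s1; apply/permP=> x; rewrite perm1.
  by apply: contrapT => sx; apply: nx; exists x.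
(* [s'] fixes [s x] as well as every fixed point of [s], so the induction on the number of moved
   cells applies. *)
pose s' := (tperm x (s x) * s)%g.
have cs' : column_preserving s'.
  apply/forallP=> z; rewrite permM; case: tpermP => [->|->|_ _].
  - by rewrite (eqP (forallP cs _)) (forallP cs).
  - by rewrite eqxx.
  - exact: (forallP cs).
have s'm : (#|[set z | s' z != z]| < m)%N.
  apply: leq_ltn_trans (_ : (#|[set z | s z != z] :\ s x| < m)%N).
    apply: subset_leq_card; apply/fintype.subsetP=> z.
    rewrite !finset.inE permM; case: tpermP => [->|->|_ /eqP zsx ->].
    - by move=> _; rewrite eq_sym sx.
    - by rewrite eqxx.
    - by rewrite zsx.
  move: sm; rewrite (cardsD1 (s x)) finset.inE.
  by rewrite (inj_eq perm_inj) sx add1n ltnS.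
have -> : fill_perm f s = [ffun z => fill_perm f s' (tperm x (s x) z)].
  by rewrite fill_perm_tperm /s' mulgA tperm2 mul1g.
rewrite alt 1?eq_sym //; last by rewrite (eqP (forallP cs x)).
rewrite (IHm _ s'm cs') odd_permM odd_tperm eq_sym sx signr_addb expr1 mulN1r.
by rewrite mulNr opprK.
Qed.

(* The tensor product over the columns of e_1 /\ ... /\ e_k. *)
Definition highest_tensor : tens K n D :=
  [ffun f => \sum_(s : {perm seq_sub D} | column_preserving s)
     (-1) ^+ s * (f == fill_perm f0 s)%:R].

Lemma highest_tensor_perm (s : {perm seq_sub D}) :
  column_preserving s -> highest_tensor (fill_perm f0 s) = (-1) ^+ s.
Proof.
move=> cs; rewrite ffunE (bigD1 s) //= eqxx mulr1 big1 ?addr0 // => s' /andP[cs' ss'].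
case: eqP => [/fill_perm_row_inj E|_]; last by rewrite mulr0.
by rewrite E ?eqxx in ss'.
Qed.

Lemma column_preserving1 : column_preserving (1 : {perm seq_sub D})%g.
Proof. by apply/forallP=> x; rewrite perm1. Qed.

Lemma fill_perm1 f : fill_perm f 1%g = f.
Proof. by apply/ffunP=> x; rewrite ffunE perm1. Qed.

Lemma highest_tensor_row : highest_tensor f0 = 1.
Proof.
by rewrite -[f0]fill_perm1 highest_tensor_perm ?column_preserving1 // odd_perm1.
Qed.

Lemma highest_tensor_neq0 : highest_tensor != 0.
Proof.
apply/eqP=> /ffunP/(_ f0); rewrite highest_tensor_row ffunE.
exact/eqP/oner_neq0.
Qed.

Lemma highest_tensor_supp f : highest_tensor f != 0 ->
  exists2 s : {perm seq_sub D}, column_preserving s & f = fill_perm f0 s.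
Proof.
move=> vf; apply: contrapT => nf; case/eqP: vf; rewrite ffunE big1 // => s cs.
by case: eqP => [fs|_]; [case: nf; exists s | rewrite mulr0].
Qed.

Lemma highest_tensor_alternating : column_alternating highest_tensor.
Proof.
move=> f x y xy cxy; pose ct s := (tperm x y * s)%g.
have ctK : involutive ct by move=> s; rewrite /ct mulgA tperm2 mul1g.
have cct s : column_preserving (ct s) = column_preserving s.
  suff cc s' : column_preserving s' -> column_preserving (ct s').
    by apply/idP/idP => [/cc|/cc//]; rewrite ctK.
  move/forallP=> cs; apply/forallP=> z; rewrite permM (eqP (cs _)).
  by case: tpermP => [->|->|]; rewrite ?cxy.
rewrite !ffunE (reindex_inj (inv_inj ctK)) /= -sumrN; apply: eq_big => // s cs.
rewrite odd_permM odd_tperm xy signr_addb expr1 mulN1r mulNr; congr (- (_ * _%:R)).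
rewrite -fill_perm_tperm; congr nat_of_bool; apply/eqP/eqP => [/ffunP E|->].
  apply/ffunP=> z; have := E (tperm x y z).
  by rewrite [LHS]ffunE [RHS]ffunE !tpermK.
by apply/ffunP=> z; rewrite !ffunE.
Qed.

(** Low weight confines the support to column permutations of [f0], and alternation determines the
    values there from the one at [f0]. *)
Lemma alternating_low t : column_alternating t ->
  (forall f, t f != 0 -> (weight f <= weight f0)%N) ->
  t = t f0 *: highest_tensor.
Proof.
move=> alt low; apply/ffunP=> f; rewrite ffunE.
have [tf|tf] := eqVneq (t f) 0; last first.
  have [s cs fs] := low_filling D_up (alternating_col_injective alt tf) (low f tf).
  rewrite fs highest_tensor_perm // (alternating_perm _ alt cs).
  by rewrite [RHS]mulrC.
have [vf|/highest_tensor_supp[s cs fs]] := eqVneq (highest_tensor f) 0.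
  by rewrite vf scaler0.
have := alternating_perm f0 alt cs; rewrite -fs tf => /esym/eqP.
by rewrite mulf_eq0 signr_eq0 => /eqP ->; rewrite scale0r.
Qed.

Lemma act_alternating (g : 'M[K]_n) t :
  column_alternating t -> column_alternating (act g t).
Proof.
move=> alt f x y xy cxy; rewrite !ffunE -sumrN.
pose tp k : filling n D := [ffun z => k (tperm x y z)].
have tpK : involutive tp by move=> k; apply/ffunP=> z; rewrite !ffunE tpermK.
rewrite (reindex_inj (inv_inj tpK)); apply: eq_bigr => k _ /=.
rewrite alt // mulrN; congr (- (_ * _)).
rewrite [RHS](reindex_inj (@perm_inj _ (tperm x y))) /=.
by apply: eq_bigr => z _; rewrite !ffunE.
Qed.

Lemma act_upper_supp (b : 'M[K]_n) t f k :
  (forall i j : 'I_n, (j < i)%N -> b i j = 0) ->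
  (\prod_x b (f x) (k x)) * t k != 0 -> t k != 0 /\ forall x, (f x <= k x)%N.
Proof.
move=> ub; rewrite mulf_eq0 negb_or => /andP[/prodf_neq0 pb tk]; split=> // x.
by rewrite leqNgt; apply/negP => /ub b0; have := pb x isT; rewrite b0 eqxx.
Qed.

Lemma highest_tensor_weight f : highest_tensor f != 0 -> weight f = weight f0.
Proof. by case/highest_tensor_supp => s _ ->; rewrite weight_perm. Qed.

(** An upper triangular matrix leads only to fillings that are cellwise at most the original ones,
    so the image has low weight. By equality of weights, only [f0] contributes to the coefficient at
    [f0]. *)
Lemma act_upper_highest (b : 'M[K]_n) :
  (forall i j : 'I_n, (j < i)%N -> b i j = 0) ->
  act b highest_tensor = (\prod_x b (f0 x) (f0 x)) *: highest_tensor.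
Proof.
move=> ub; rewrite [LHS]alternating_low.
- congr (_ *: _); rewrite ffunE (bigD1 f0) //= highest_tensor_row mulr1.
  rewrite [X in _ + X]big1 ?addr0 //.
  move=> k kf0; apply/eqP; apply: contraNT kf0 => /(act_upper_supp ub)[vk fk].
  apply/eqP/ffunP=> x; apply: val_inj; apply/eqP; rewrite eqn_leq fk andbT.
  have := highest_tensor_weight vk; rewrite /weight (bigD1 x) //= [RHS](bigD1 x) //=.
  have : (\sum_(i | i != x) f0 i <= \sum_(i | i != x) k i)%N by apply: leq_sum.
  move=> le eq; rewrite leqNgt; apply/negP => lt.
  by have := leq_add lt le; rewrite addSn eq ltnn.
- exact/act_alternating/highest_tensor_alternating.
- move=> f; rewrite ffunE => /eqP sn0.
  have [k] : exists k, (\prod_x b (f x) (k x)) * highest_tensor k != 0.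
    apply: contrapT => nk; apply: sn0; apply: big1 => k _; apply/eqP.
    by apply: contrapT => kn; apply: nk; exists k; apply/negP.
  case/(act_upper_supp ub) => /highest_tensor_weight <- fk.
  exact: leq_sum.
Qed.

End AlternatingTensors.

(** * The Schur module and its dual *)

(** A subspace of maximal dimension inside [P] absorbs every vector of [P]. Stable hulls and
    orthogonal complements become subspaces in this way. *)
Lemma vspace_of_pred (K : fieldType) (E : vectType K) (P : E -> Prop) :
  P 0 -> (forall c u v, P u -> P v -> P (c *: u + v)) ->
  exists U : {vspace E}, forall v, v \in U <-> P v.
Proof.
move=> P0 PD.
pose inP (U : {vspace E}) := forall v, v \in U -> P v.
have ex : exists d, `[< exists2 U, \dim U = d & inP U >].
  exists (\dim (0%VS : {vspace E})); apply/asboolP; exists 0%VS => // v.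
  by rewrite memv0 => /eqP ->.
have ub d : `[< exists2 U, \dim U = d & inP U >] -> (d <= \dim {:E})%N.
  by move=> /asboolP[U <- _]; apply/dimvS/subvf.
case: (ex_maxnP ex ub) => d /asboolP[U dU UP] dmax; exists U => v; split=> [/UP //|Pv].
have VP : inP (<[v]> + U)%VS.
  move=> w /memv_addP[_ /vlineP[c ->] [u /UP Pu ->]]; exact: PD.
have : (\dim (<[v]> + U) <= \dim U)%N.
  by rewrite dU; apply: dmax; apply/asboolP; exists (<[v]> + U)%VS.
rewrite (geq_leqif (dimv_leqif_sup (addvSr <[v]>%VS U))) => /subvP; apply.
by apply: (subvP (addvSl _ _)); apply: memv_line.
Qed.

Lemma prod_seq_sub (R : comNzRingType) (T : choiceType) (s : seq T) (F : T -> R) :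
  uniq s -> \prod_(x : seq_sub s) F (val x) = \prod_(x <- s) F x.
Proof.
move=> us; rewrite -(big_map val predT F); apply: perm_big; apply: uniq_perm => //.
  by rewrite map_inj_uniq ?index_enum_uniq //; apply: val_inj.
move=> x; apply/mapP/idP => [[y _ ->]|xs]; first exact: valP.
by exists (SeqSub xs); rewrite ?mem_index_enum.
Qed.

Lemma mem_diagram la r c :
  ((r, c) \in diagram la) = (r < size la)%N && (c < nth 0%N la r)%N.
Proof.
apply/allpairsPdep/andP => [[r' [c' [r's c'l [-> ->]]]]|[rs cl]].
  by move: r's c'l; rewrite !mem_iota nth_nil subn0 !add0n.
by exists r, c; rewrite !mem_iota nth_nil subn0 !add0n.
Qed.

Lemma diagram_uniq la : uniq (diagram la).
Proof.
apply: allpairs_uniq_dep; first exact: iota_uniq.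
  by move=> r _; apply: iota_uniq.
by move=> [r c] [r' c'] _ _ /= [-> ->].
Qed.

Section Highest.

Variables (K : numClosedFieldType) (n : nat) (la : seq nat).
Hypothesis la_part : is_partition la.
Hypothesis la_size : (size la <= n)%N.

Notation D := (diagram la).
Implicit Types (t u v : tens K n D) (f : filling n D) (g : 'M[K]_n).
Implicit Types (U : {vspace tens K n D}).

Lemma diagram_up r c r' : (r, c) \in D -> (r' <= r)%N -> (r', c) \in D.
Proof.
rewrite !mem_diagram => /andP[rs cr] r'r; rewrite (leq_ltn_trans r'r rs) /=.
apply: leq_trans cr _; have /andP[sla _] := la_part.
apply: (sorted_leq_nth _ _ 0%N sla) => //; first exact: (rev_trans leq_trans).
  exact: leqnn.
exact: leq_ltn_trans r'r rs.
Qed.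

Lemma diagram_rows r c : (r, c) \in D -> (r < n)%N.
Proof. by rewrite mem_diagram => /andP[rs _]; apply: leq_trans rs la_size. Qed.

Local Notation f0 := (row_filling diagram_rows).
Local Notation hv := (highest_tensor K diagram_rows).

Lemma prod_row_filling (d : 'I_n -> K) :
  \prod_x d (f0 x) = \prod_i d i ^+ nth 0%N la i.
Proof.
pose F (y : nat * nat) := oapp d 1 (insub y.1 : option 'I_n).
transitivity (\prod_(x : seq_sub D) F (val x)).
  apply: eq_bigr => x _; rewrite /F ffunE insubT //=.
    exact: cell_row_lt diagram_rows x.
  by move=> H; congr d; apply: val_inj.
rewrite prod_seq_sub ?diagram_uniq // big_allpairs_dep /=.
transitivity (\prod_(0 <= r < size la)
    oapp d 1 (insub r : option 'I_n) ^+ nth 0%N la r).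
  rewrite /index_iota subn0; apply: eq_bigr => r _.
  by rewrite nth_nil subn0 /F /= big_const_seq count_predT size_iota iter_mulr_1.
rewrite (big_nat_widen _ _ n) // big_mkcond /= big_mkord; apply: eq_bigr => i _.
rewrite valK /=; case: ltnP => // si.
by rewrite nth_default.
Qed.

Lemma highest_tensor_hwv : highest_weight_vector la hv.
Proof.
split=> [|b _ ub]; first exact: highest_tensor_neq0.
by rewrite (act_upper_highest diagram_up) // (prod_row_filling (fun i => b i i)).
Qed.

Definition torus : 'M[K]_n := diag_mx (\row_i 2%:R ^+ i).

Lemma torus_unit : torus \in unitmx.
Proof.
rewrite unitmxE det_diag unitfE; apply/prodf_neq0 => i _; rewrite mxE.
by rewrite expf_neq0 // pnatr_eq0.
Qed.

Lemma act_diag (d : 'rV[K]_n) t f :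
  act (diag_mx d) t f = (\prod_x d 0 (f x)) * t f.
Proof.
rewrite ffunE (bigD1 f) //= [X in _ + X]big1 ?addr0 => [|k kf].
  by congr (_ * _); apply: eq_bigr => x _; rewrite mxE eqxx.
apply/eqP; apply: contraNT kf; rewrite mulf_eq0 negb_or => /andP[/prodf_neq0 fk _].
apply/eqP/ffunP=> x; have := fk x isT; rewrite mxE.
by case: (f x =P k x) => // _; rewrite mulr0n eqxx.
Qed.

Lemma act_torus t f : act torus t f = 2%:R ^+ weight f * t f.
Proof.
rewrite act_diag; congr (_ * _); rewrite /weight expr_sum.
by apply: eq_bigr => x _; rewrite mxE.
Qed.

Lemma exp2_inj : injective (fun k => 2%:R ^+ k : K).
Proof.
by apply: ieexprIn; rewrite ?ltr0n // (eqr_nat K 2 1).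
Qed.

(** A single torus element suffices: its eigenvalue on [v] fixes the power of 2, hence [weight], for
    every filling in the support. *)
Lemma highest_weight_unique v :
  column_alternating v -> highest_weight_vector la v -> v = v f0 *: hv.
Proof.
move=> alt [_ hwv]; apply: (alternating_low diagram_up) => // f vf.
have tri (i j : 'I_n) : (j < i)%N -> torus i j = 0.
  by rewrite mxE; case: eqP => // -> /[!ltnn].
have /ffunP/(_ f) := hwv torus torus_unit tri; rewrite act_torus !ffunE.
under eq_bigr => i _ do rewrite mxE eqxx mulr1n mxE.
rewrite -(prod_row_filling (fun i => 2%:R ^+ i)) -expr_sum => E.
by rewrite (exp2_inj (mulIf vf E)).
Qed.

(* Lagrange interpolation in the operator [act torus]. *)
Lemma weight_projection U u w0 :
  (forall t, t \in U -> act torus t \in U) -> u \in U ->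
  exists u', [/\ u' \in U,
    forall f, u' f = if weight f == w0 then u f else 0 &
    forall psi : tens K n D -> K,
      (forall c x y, psi (c *: x + y) = c * psi x + psi y) ->
      (forall t, t \in U -> psi (act torus t) = 2%:R ^+ w0 * psi t) ->
      psi u' = psi u].
Proof.
move=> Ut uU; pose e d : K := 2%:R ^+ d.
(* All weights that can occur except [w0]: each cell contributes less than [n]. *)
pose l := [seq d <- iota 0 (\sum_(x : seq_sub D) n).+1 | d != w0].
have l0 d : d \in l -> e w0 - e d != 0.
  rewrite mem_filter => /andP[dw _]; rewrite subr_eq0; apply: contraNneq dw.
  by move/exp2_inj ->.
have [u' [u'U u'E u'psi]] : exists u', [/\ u' \in U,
    forall f, u' f = (\prod_(d <- l) ((e (weight f) - e d) / (e w0 - e d))) * u f &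
    forall psi : tens K n D -> K,
      (forall c x y, psi (c *: x + y) = c * psi x + psi y) ->
      (forall t, t \in U -> psi (act torus t) = e w0 * psi t) ->
      psi u' = psi u].
  elim: (l) l0 => [|d m IHm] l0.
    by exists u; split=> // f; rewrite big_nil mul1r.
  have [|u' [u'U u'E u'psi]] := IHm.
    by move=> d' d'm; apply: l0; rewrite seq.inE d'm orbT.
  have d0 : e w0 - e d != 0 by apply: l0; rewrite seq.inE eqxx.
  exists ((e w0 - e d)^-1 *: (- e d *: u' + act torus u')); split.
  - by rewrite memvZ // memvD ?memvZ ?Ut.
  - move=> f; rewrite big_cons -mulrA -u'E tensZ tensD tensZ act_torus.
    by rewrite -mulrDl [- e d + _]addrC mulrA [_^-1 * _]mulrC.
  (* Each interpolation factor takes the value 1 at the eigenvalue of [psi], so [psi] does not see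
     the projection. *)
  - move=> psi plin pt; rewrite -[X in psi X]addr0 plin.
    have psi0 : psi 0 = 0.
      by have := plin (-1) 0 0; rewrite scaler0 addr0 mulN1r addNr.
    rewrite psi0 addr0 plin pt // -mulrDl [- e d + _]addrC mulrA mulVf // mul1r.
    exact: u'psi.
exists u'; split=> // f; rewrite u'E; case: eqP => [->|/eqP fw].
  rewrite big_seq big1 ?mul1r // => d dl; rewrite divff //; exact: l0.
suff fl : weight f \in l by rewrite (big_rem _ fl) /= subrr !mul0r.
rewrite mem_filter fw mem_iota /= ltnS; apply: leq_sum => x _.
exact: ltnW.
Qed.

Definition conjt t : tens K n D := [ffun f => (t f)^*].

Lemma conjt_act g t : conjt (act g t) = act (map_mx Num.conj g) (conjt t).
Proof.
apply/ffunP=> f; rewrite !ffunE rmorph_sum; apply: eq_bigr => k _.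
rewrite rmorphM rmorph_prod ffunE; congr (_ * _).
by apply: eq_bigr => x _; rewrite mxE.
Qed.

Lemma dot_conj_eq0 t : dot t (conjt t) = 0 -> t = 0.
Proof.
rewrite /dot; under eq_bigr => f _ do rewrite ffunE -normCK.
move=> /eqP; rewrite psumr_eq0 => [/allP t0|f _]; last by rewrite exprn_ge0.
apply/ffunP=> f; have := t0 f; rewrite mem_index_enum => /(_ isT).
by rewrite sqrf_eq0 normr_eq0 ffunE => /eqP.
Qed.

Lemma alternating_vspace : exists A : {vspace tens K n D},
  forall t, t \in A <-> column_alternating t.
Proof.
apply: vspace_of_pred => [f x y _ _|c t u At Au f x y xy cxy].
  by rewrite !ffunE oppr0.
by rewrite !ffunE At // Au // scalerN opprD.
Qed.

Lemma dot_highest_supp u :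
  (forall f, weight f = weight f0 -> u f = 0) -> dot u hv = 0.
Proof.
move=> u0; apply: big1 => f _.
have [->|vf] := eqVneq (hv f) 0; first by rewrite mulr0.
by rewrite u0 ?mul0r // (highest_tensor_weight vf).
Qed.

Lemma conjt_highest : conjt hv = hv.
Proof.
apply/ffunP=> f; rewrite ffunE; have [->|] := eqVneq (hv f) 0.
  by rewrite rmorph0.
case/highest_tensor_supp => s cs ->; rewrite highest_tensor_perm //.
by rewrite rmorphXn rmorphN rmorph1.
Qed.

(* The smallest stable subspace containing [hv] is irreducible: a stable subspace
   not containing [hv] has no component of extremal weight, hence its Hermitian
   complement is a stable subspace containing [hv]. *)
Lemma schur_exists : exists S : {vspace tens K n D}, is_schur S.
Proof.
pose P v := forall U, gl_stable U -> hv \in U -> v \in U.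
have [S SP] : exists S : {vspace tens K n D}, forall v, v \in S <-> P v.
  apply: vspace_of_pred => [U _ _|c u v Pu Pv U Ust hU]; first exact: mem0v.
  by rewrite memvD ?memvZ ?Pu ?Pv.
have hS : hv \in S by apply/SP.
have Smin U : gl_stable U -> hv \in U -> (S <= U)%VS.
  by move=> Ust hU; apply/subvP=> v /SP; apply.
have Sst : gl_stable S.
  by move=> g t gU /SP Pt; apply/SP => U Ust hU; exact: Ust gU (Pt _ Ust hU).
have [A AP] := alternating_vspace.
have SA : (S <= A)%VS.
  apply: Smin => [g t _ /AP At|]; last exact/AP/highest_tensor_alternating.
  exact/AP/act_alternating.
exists S; split=> //; first by move=> t /(subvP SA)/AP.
  split=> [|U US Ust].
    apply: contraNneq (highest_tensor_neq0 K diagram_rows) => S0.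
    by rewrite S0 memv0 in hS.
  have [hU|hU] := boolP (hv \in U).
    by right; apply/eqP; rewrite eqEsubv US Smin.
  left; apply/eqP; rewrite -subv0; apply/subvP=> u uU; rewrite memv0; apply/eqP.
  (* The extremal part of [w] lies in [U] and is a multiple of [hv]; as [hv] is not in [U], this
     part vanishes. *)
  have low w : w \in U -> dot w hv = 0.
    move=> wU; apply: dot_highest_supp => f wf.
    have [|w' [w'U w'E _]] := @weight_projection U w (weight f0) _ wU.
      by move=> t; apply: Ust; apply: torus_unit.
    have alt : column_alternating w' by apply/AP/(subvP SA)/(subvP US).
    have : w' = w' f0 *: hv.
      apply: (alternating_low diagram_up) => // k; rewrite w'E.
      by case: ifP => [/eqP -> //|_]; rewrite eqxx.
    have -> : w' f0 = 0.
      apply: contraNeq hU => w'0; rewrite -[hv]scale1r -(mulVf w'0) -scalerA.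
      rewrite memvZ // -(alternating_low diagram_up) // => k; rewrite w'E.
      by case: ifP => [/eqP -> //|_]; rewrite eqxx.
    by rewrite scale0r => /ffunP/(_ f); rewrite w'E wf eqxx ffunE.
  apply: dot_conj_eq0; pose Q w := forall t, t \in U -> dot t (conjt w) = 0.
  have [W WP] : exists W : {vspace tens K n D}, forall w, w \in W <-> Q w.
    apply: vspace_of_pred => [t _|c w w' Qw Qw' t tU].
      by rewrite /dot big1 // => f _; rewrite !ffunE rmorph0 mulr0.
    have -> : conjt (c *: w + w') = c^* *: conjt w + conjt w'.
      by apply/ffunP=> f; rewrite !ffunE rmorphD; congr (_ + _); apply: rmorphM.
    by rewrite linearP /= Qw // Qw' // mulr0 addr0.
  (* [U] lies in [S], and [S] in the complement of [U], so [u] is orthogonal to itself. *)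
  suff /subvP/(_ u) : (S <= W)%VS by move=> /(_ (subvP US _ uU))/WP; apply.
  apply: Smin => [g w gU /WP Qw|].
    (* The adjoint of [act g] is the action of the conjugate transpose, again an invertible
       matrix. *)
    apply/WP => t tU; rewrite conjt_act dotC dot_act dotC; apply: Qw.
    apply: Ust => //; rewrite unitmx_tr unitmxE det_map_mx unitfE fmorph_eq0.
    by rewrite -unitfE -unitmxE.
  by apply/WP => t tU; rewrite conjt_highest low.
by exists hv; last exact: highest_tensor_hwv.
Qed.

Lemma schurP : is_schur (schur K n la).
Proof. exact: xgetPex schur_exists. Qed.

(** Whatever module the choice in [schur] returns, its highest weight vector is a nonzero multiple
    of [hv]. *)
Lemma highest_tensor_schur : hv \in schur K n la.
Proof.
have [alt _ _ [v vS hwv]] := schurP.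
have v0 : v f0 != 0.
  apply: contraNneq hwv.1 => v0.
  by rewrite (highest_weight_unique (alt _ vS) hwv) v0 scale0r.
rewrite -[hv]scale1r -(mulVf v0) -scalerA memvZ //.
by rewrite -highest_weight_unique //; apply: alt.
Qed.

Lemma dot_highest : 0 < dot hv hv.
Proof.
rewrite /dot (bigD1 f0) //= highest_tensor_row mulr1.
apply: ltr_pwDl => //; apply: sumr_ge0 => f _.
have [->|] := eqVneq (hv f) 0; first by rewrite mulr0.
case/highest_tensor_supp => s cs ->; rewrite highest_tensor_perm //.
by rewrite -expr2 sqrr_sign.
Qed.

(** The radical of the form is stable because transposes of invertible matrices are invertible. By
    irreducibility it is zero or everything, and the latter contradicts [dot_highest]. *)
Lemma schur_dot_nondegenerate u : u \in schur K n la ->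
  (forall w, w \in schur K n la -> dot u w = 0) -> u = 0.
Proof.
move=> uS u0; have [_ Sst [_ irr] _] := schurP.
pose P u := u \in schur K n la /\ forall w, w \in schur K n la -> dot u w = 0.
have [W WP] : exists W : {vspace tens K n D}, forall w, w \in W <-> P w.
  apply: vspace_of_pred => [|c v v' [vS v0] [v'S v'0]].
    by split=> [|w _]; [exact: mem0v | rewrite dotC linear0].
  split=> [|w wS]; first by rewrite memvD ?memvZ.
  by rewrite dot_linearl v0 // v'0 // mulr0 addr0.
have : u \in W by apply/WP.
case: (irr W) => [|g t gU /WP[tS t0]|->|WS].
- by apply/subvP=> w /WP[].
- apply/WP; split=> [|w wS]; first exact: Sst.
  by rewrite dot_act t0 // Sst ?unitmx_tr.
- by rewrite memv0 => /eqP.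
- have := highest_tensor_schur; rewrite -WS => /WP[_ /(_ _ highest_tensor_schur)].
  by move=> h0; have := dot_highest; rewrite h0 ltxx.
Qed.

Lemma schur_is_schur_dual : is_schur_dual (schur K n la).
Proof.
have [alt Sst _ _] := schurP; split=> // [g phi gU phiS|].
  by apply: Sst => //; rewrite unitmx_tr unitmx_inv.
exists (@dot K n D); split.
- by move=> c x y u; rewrite dot_linearl.
- by move=> c x u v; rewrite linearP.
- by move=> g phi u gU _ _; apply: dot_act_dual.
- exact: schur_dot_nondegenerate.
- by move=> u uS u0; apply: schur_dot_nondegenerate => // w wS; rewrite dotC u0.
Qed.

(* A module dual to [schur] has a vector of extremal weight, since it pairs
   nontrivially with [hv]; being alternating, that vector is a multiple of [hv]. *)
Lemma schur_dualE : schur_dual K n la = schur K n la.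
Proof.
have := @xgetPex _ 0%VS (@is_schur_dual K n la) (ex_intro _ _ schur_is_schur_dual).
rewrite -/(schur_dual K n la); set S' := schur_dual K n la.
case=> alt S'd [b [bl br binv ndl ndr]]; have [_ Sst [_ irr] _] := schurP.
have S'st : gl_stable S'.
  move=> g t gU tS'; have := S'd (invmx g)^T t.
  by rewrite unitmx_tr unitmx_inv /act_dual trmx_inv trmxK invmxK => /(_ gU tS').
have hS := highest_tensor_schur.
have [phi phiS' bphi] : exists2 phi, phi \in S' & b phi hv <> 0.
  apply: contrapT => nb; case/eqP: (highest_tensor_neq0 K diagram_rows).
  apply: ndr => // phi phiS'; apply: contrapT => bphi; apply: nb.
  by exists phi.
have acth : act torus hv = 2%:R ^+ weight f0 *: hv.
  apply/ffunP=> f; rewrite act_torus tensZ.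
  have [->|vf] := eqVneq (hv f) 0; first by rewrite !mulr0.
  by rewrite (highest_tensor_weight vf).
have b0 x : b x 0 = 0.
  by have := br (-1) x 0 0; rewrite scaler0 addr0 mulN1r addNr.
have bZ c x v : b x (c *: v) = c * b x v.
  by rewrite -[c *: v]addr0 br b0 addr0.
have [phi' [phi'S' phi'E]] := @weight_projection S' phi (weight f0)
  (fun t => S'st _ t torus_unit) phiS'.
move=> /(_ (b^~ hv)) phi'b.
have : phi' = phi' f0 *: hv.
  apply: (alternating_low diagram_up); first exact: alt.
  by move=> f; rewrite phi'E; case: ifP => [/eqP -> //|_]; rewrite eqxx.
have [->|c0] := eqVneq (phi' f0) 0.
  rewrite scale0r => phi'0; case: bphi; rewrite -phi'b.
  - rewrite phi'0; have := bl (-1) 0 0 hv.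
    by rewrite scaler0 addr0 mulN1r addNr.
  - by move=> c x y; apply: bl.
  move=> t tS'.
  (* The torus is symmetric, so [act_dual] undoes [act], and invariance of [b] moves the eigenvalue
     of [hv] to the first argument. *)
  have dt : act_dual torus (act torus t) = t.
    by rewrite /act_dual -act_mul trmx_inv tr_diag_mx mulVmx ?act1 ?torus_unit.
  have := binv torus (act torus t) hv torus_unit (S'st _ _ torus_unit tS') hS.
  by rewrite dt acth bZ.
move=> phi'h; have hS' : hv \in S'.
  by rewrite -[hv]scale1r -(mulVf c0) -scalerA -phi'h memvZ.
have SS' : (schur K n la <= S')%VS.
  case: (irr (schur K n la :&: S')%VS) => [|g t gU|cap0|cap].
  - exact: capvSl.
  - by rewrite !memv_cap => /andP[tS tS']; rewrite Sst ?S'st.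
  - have : hv \in (schur K n la :&: S')%VS by rewrite memv_cap hS hS'.
    by rewrite cap0 memv0 (negbTE (highest_tensor_neq0 K diagram_rows)).
  - by rewrite -cap capvSr.
(* Equality follows by dimension: nondegeneracy of [b] embeds [S'] into the dual of the Schur
   module, written here as rows of length [k]. *)
apply/esym/eqP; rewrite -(geq_leqif (dimv_leqif_eq SS')).
pose k := \dim (schur K n la); pose e := vbasis (schur K n la).
have klin : linear (fun x => \row_(i < k) b x e`_i).
  by move=> c x y; apply/rowP=> i; rewrite !mxE bl.
pose kap : {linear tens K n D -> 'rV[K]_k} :=
  HB.pack (fun x => \row_(i < k) b x e`_i)
    (GRing.isLinear.Build K (tens K n D) 'rV[K]_k *:%R _ klin).
have ker0 : (S' :&: lker (linfun kap))%VS = 0%VS.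
  apply/eqP; rewrite -subv0; apply/subvP=> x; rewrite memv_cap memv_ker lfunE memv0.
  move=> /andP[xS' /eqP/rowP x0]; apply/eqP; apply: ndl => // u uS.
  rewrite (coord_vbasis uS).
  elim/big_rec: _ => [|i y _ by0]; first exact: b0.
  by rewrite br by0 addr0; have := x0 i; rewrite !mxE => ->; rewrite mulr0.
rewrite -(limg_ker_dim (linfun kap) S') ker0 dimv0 add0n.
by apply: leq_trans (dimvS (subvf _)) _; rewrite dimvf /dim /= mul1n.
Qed.

End Highest.

(** * Apolarity in degree lambda *)

Lemma skew_diagram_self la : skew_diagram la la = [::].
Proof.
rewrite /skew_diagram; elim: (iota 0 _) => //= r s IHs.
by rewrite subnn /= IHs.
Qed.

(** The skew diagram is empty, so the target has a single coordinate, and the scalar made of inverse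
    factorials is nonzero in characteristic 0. *)
Lemma apolar_self_eq0 (K : numFieldType) (n : nat) (la : seq nat)
    (phi t : tens K n (diagram la)) : apolar phi t = 0 <-> dot phi t = 0.
Proof.
rewrite /apolar; have -> : sub_part la la by apply/allP => r _; apply: leqnn.
have no (x : seq_sub (skew_diagram la la)) : False.
  by case: x => y yD; move: (yD); rewrite [X in _ \in X]skew_diagram_self.
pose h : filling n (skew_diagram la la) := [ffun x => False_rect _ (no x)].
set T := [ffun _ => _]; have TE k : T k = dot phi t.
  rewrite ffunE; apply: eq_bigr => f _; rewrite (big_pred1 f) // => k' /=.
  apply/andP/eqP => [[/forallP fk _]|->].
    by apply/ffunP=> x; have /forallP/(_ x) := fk x; rewrite eqxx => /eqP ->.
  split; apply/forallP => x; last by case: (no x).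
  by apply/forallP => y; apply/implyP => /eqP/val_inj ->.
split=> [|d0].
  move=> /ffunP/(_ h)/eqP; rewrite tensZ TE ffunE mulf_eq0 invr_eq0 => /orP[|/eqP //].
  by case/prodf_eq0 => c _; rewrite pnatr_eq0 -leqn0 leqNgt fact_gt0.
rewrite (_ : T = 0) ?scaler0 //; apply/ffunP=> k; by rewrite TE d0 ffunE.
Qed.

Lemma apolar0l (K : fieldType) (n : nat) (mu la : seq nat)
    (t : tens K n (diagram la)) : apolar (0 : tens K n (diagram mu)) t = 0.
Proof.
rewrite /apolar; case: ifP => // _; rewrite (_ : finfun _ = 0) ?scaler0 //.
apply/ffunP=> h; rewrite !ffunE big1 // => f _; rewrite big1 // => k _.
by rewrite ffunE mul0r.
Qed.

Lemma lie_dual0 (K : fieldType) (n : nat) D xi :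
  lie_dual xi (0 : tens K n D) = 0.
Proof.
apply/ffunP=> f; rewrite !ffunE big1 ?oppr0 // => x _; rewrite big1 // => j _.
by rewrite ffunE mulr0.
Qed.

(** A family concentrated in [lam] meets no condition in other degrees, and [dot_lie_dual] transfers
    the derivation from [phi] to the point. *)
Lemma component_schur_squareP (K : numFieldType) (n : nat) (lam : part n)
    (P : proj (schur_space K n (parts lam)))
    (phi : tens K n (diagram (parts lam))) :
  component (schur_square P) lam phi <->
  phi \in schur_dual K n (parts lam) /\
  forall p, p \in line P -> dot phi (vsval p) = 0 /\
    forall xi, dot phi (lie xi (vsval p)) = 0.
Proof.
have sE mu (psi : tens K n (diagram (parts lam))) : mu != lam -> single psi mu = 0.
  by move=> ml; rewrite /single dfwith_out // eq_sym.
have sI (psi : tens K n (diagram (parts lam))) : single psi lam = psi.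
  by rewrite /single dfwith_in.
split=> [[phiS [_ sq]]|[phiS phi0]]; split=> //.
  move=> p /sq[p0 xp0]; split.
    by apply/apolar_self_eq0; have := p0 lam; rewrite sI.
  move=> xi; have := xp0 xi lam; rewrite /family_lie sI => /apolar_self_eq0.
  by rewrite dot_lie_dual => /eqP; rewrite oppr_eq0 => /eqP.
split=> [|p pP].
  split=> [a|]; last first.
    exists [:: lam] => a; rewrite mem_seq1 => al.
    exact: sE.
  have [->|al] := eqVneq a lam; first by rewrite sI.
  by rewrite sE // mem0v.
have [p0 xp0] := phi0 _ pP; split=> [mu|xi mu].
  have [->|ml] := eqVneq mu lam; first by rewrite sI; apply/apolar_self_eq0.
  by rewrite sE // apolar0l.
rewrite /family_lie; have [->|ml] := eqVneq mu lam; last first.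
  by rewrite sE // lie_dual0 apolar0l.
by rewrite sI; apply/apolar_self_eq0; rewrite dot_lie_dual xp0 oppr0.
Qed.

(** * Secant varieties *)

Section Coordinates.

Variables (K : fieldType) (E : vectType K).
Implicit Types (u v : E).

Lemma crdP c u v i : crd (c *: u + v) i = c * crd u i + crd v i.
Proof. by rewrite /crd linearP. Qed.

Lemma crd0 i : crd (0 : E) i = 0.
Proof. by rewrite /crd linear0. Qed.

Lemma crdZ c u i : crd (c *: u) i = c * crd u i.
Proof. by rewrite /crd linearZ. Qed.

Lemma crd_sum (I : Type) (r : seq I) (P : pred I) (F : I -> E) i :
  crd (\sum_(k <- r | P k) F k) i = \sum_(k <- r | P k) crd (F k) i.
Proof. by rewrite /crd linear_sum. Qed.

Lemma crd_inj u v : crd u =1 crd v -> u = v.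
Proof.
move=> uv; rewrite (coord_vbasis (memvf u)) (coord_vbasis (memvf v)).
by apply: eq_bigr => i _; congr (_ *: _); apply: uv.
Qed.

Definition of_crd (y : 'I_(ndim E) -> K) : E := \sum_i y i *: (vbasis {:E})`_i.

Lemma of_crdK y : crd (of_crd y) =1 y.
Proof. by move=> i; rewrite /crd coord_sum_free // (basis_free (vbasisP _)). Qed.

Lemma crdE u : u = \sum_i crd u i *: (vbasis {:E})`_i.
Proof. exact: coord_vbasis (memvf u). Qed.

End Coordinates.

Section LinearPullback.

Variables (K : fieldType) (E' E : vectType K) (l : E' -> E).
Hypothesis l_lin : linear l.

Definition linear_form (j : 'I_(ndim E)) : {mpoly K[ndim E']} :=
  \sum_(i < ndim E') crd (l (vbasis {:E'})`_i) j *: 'X_i.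

Lemma linear_formE v j : (linear_form j).@[crd v] = crd (l v) j.
Proof.
pose l' : {linear E' -> E} := HB.pack l (GRing.isLinear.Build _ _ _ _ _ l_lin).
have -> : l v = \sum_i crd v i *: l (vbasis {:E'})`_i.
  rewrite {1}[v]crdE -[LHS]/(l' _) linear_sum; apply: eq_bigr => i _.
  by rewrite linearZ.
rewrite crd_sum raddf_sum; apply: eq_bigr => i _.
by rewrite /= mevalZ mevalXU crdZ mulrC.
Qed.

Lemma ev_linear_pullback f v : ev (msubst linear_form f) v = ev f (l v).
Proof.
by rewrite /ev meval_msubst; apply: meval_eq => j; apply: linear_formE.
Qed.

End LinearPullback.

Lemma homog_meval (R : comNzRingType) m e (f : {mpoly R[m]}) c x :
  f \is e.-homog -> f.@[fun i => c * x i] = c ^+ e * f.@[x].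
Proof.
move=> /dhomogP fe; rewrite !mevalE mulr_sumr big_seq [RHS]big_seq.
apply: eq_bigr => mm /fe /= <-; rewrite mulrCA; congr (_ * _).
rewrite mdegE -prodrXr -big_split; apply: eq_bigr => i _.
by rewrite exprMn.
Qed.

(** [H] is y_max^e G(y_i / y_max); as e exceeds the degree of [G], no denominators remain. *)
Lemma homogenization (K : numFieldType) d (G : {mpoly K[d]}) : G != 0 ->
  exists H : {mpoly K[d.+1]}, H != 0 /\
    forall y : 'I_d.+1 -> K, y ord_max != 0 -> H.@[y] != 0 ->
      G.@[fun i => y (lift ord_max i) / y ord_max] != 0.
Proof.
move=> G0; pose e := msize G.
pose H : {mpoly K[d.+1]} := \sum_(m <- msupp G) G@_m *:
  (\prod_i 'X_(lift ord_max i) ^+ m i * 'X_ord_max ^+ (e - mdeg m)).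
have HE y : y ord_max != 0 ->
    H.@[y] = y ord_max ^+ e * G.@[fun i => y (lift ord_max i) / y ord_max].
  move=> y0; rewrite /H raddf_sum mevalE mulr_sumr /= big_seq [RHS]big_seq.
  apply: eq_bigr => m /msize_mdeg_lt/ltnW me.
  rewrite mevalZ mevalM rmorphXn rmorph_prod /= mevalXU [RHS]mulrCA.
  congr (_ * _); under [in RHS]eq_bigr => i _ do rewrite expr_div_n.
  rewrite -[in RHS](subnK (me : (mdeg m <= e)%N)) exprD mulrC -mulrA; congr (_ * _).
  rewrite big_split /= prodfV -expr_sum -mdegE mulrCA divff ?expf_neq0 //.
  by rewrite mulr1; apply: eq_bigr => i _; rewrite rmorphXn /= mevalXU.
exists H; split=> [|y y0].
  have [x Gx] := mpoly_neq0_meval G0.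
  pose y k := oapp x 1 (unlift (@ord_max d) k).
  have yM : y ord_max = 1 by rewrite /y unlift_none.
  apply: contraNneq Gx => H0; have := HE y; rewrite yM H0 meval0 expr1n mul1r.
  move=> /(_ (oner_neq0 _)) ->; apply/eqP; apply: meval_eq => i.
  by rewrite divr1 /y liftK.
by rewrite HE // mulf_eq0 negb_or => /andP[].
Qed.

(** * Terracini's lemma for a polynomially parametrized orbit *)

Section Terracini.

Variables (K : numClosedFieldType) (E : vectType K) (m s : nat).
Variables (psi : 'I_(ndim E) -> {mpoly K[m]}) (delta : {mpoly K[m]}).
Variables (J : finType) (tau : J -> E -> E) (F : set (proj E)).

Local Notation M := (ndim E).

(** [psi] parametrizes the orbit on the locus where [delta] is nonzero (later: matrix entries and
    the determinant), and the [tau j] stand for the matrix units of gl(V). By the hypotheses the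
    velocities and the [tau j] at a point span the same space, which contains the point. *)
Definition orbit_point (x : 'I_m -> K) : E := of_crd (fun i => (psi i).@[x]).

Definition orbit_velocity (x : 'I_m -> K) (c : 'I_m) : E :=
  of_crd (fun i => (psi i)^`M(c).@[x]).

Hypothesis delta_neq0 : delta != 0.
Hypothesis tau_linear : forall j, linear (tau j).
Hypothesis orbit_point_neq0 : forall x, delta.@[x] != 0 -> orbit_point x != 0.
Hypothesis F_orbit : forall P,
  F P <-> exists2 x, delta.@[x] != 0 & line P = <[orbit_point x]>%VS.
Hypothesis velocity_tau : forall x c, delta.@[x] != 0 ->
  exists a : J -> K, orbit_velocity x c = \sum_j a j *: tau j (orbit_point x).
Hypothesis tau_velocity : forall x j, delta.@[x] != 0 ->
  exists b : 'I_m -> K, tau j (orbit_point x) = \sum_c b c *: orbit_velocity x c.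
Hypothesis point_tau : forall x, delta.@[x] != 0 ->
  exists a : J -> K, orbit_point x = \sum_j a j *: tau j (orbit_point x).
Hypothesis s_gt0 : (0 < s)%N.

Local Notation N := #|{: 'I_s * option 'I_m}|.

Definition scale_var (i : 'I_s) : 'I_N := enum_rank (i, None).
Definition group_var (i : 'I_s) (c : 'I_m) : 'I_N := enum_rank (i, Some c).

Definition secant_map (l : 'I_M) : {mpoly K[N]} :=
  \sum_i 'X_(scale_var i) * msubst (fun c => 'X_(group_var i c)) (psi l).

Definition delta_prod : {mpoly K[N]} :=
  \prod_i msubst (fun c => 'X_(group_var i c)) delta.

Definition params (a : 'I_s -> K) (x : 'I_s -> 'I_m -> K) (k : 'I_N) : K :=
  let: (i, o) := enum_val k in if o is Some c then x i c else a i.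

Lemma params_scale a x i : params a x (scale_var i) = a i.
Proof. by rewrite /params enum_rankK. Qed.

Lemma params_group a x i c : params a x (group_var i c) = x i c.
Proof. by rewrite /params enum_rankK. Qed.

Lemma meval_group i p (z : 'I_N -> K) :
  (msubst (fun c => 'X_(group_var i c)) p).@[z] = p.@[fun c => z (group_var i c)].
Proof. by rewrite meval_msubst; apply: meval_eq => c; rewrite mevalXU. Qed.

Definition secant_point (z : 'I_N -> K) : E :=
  \sum_i z (scale_var i) *: orbit_point (fun c => z (group_var i c)).

Lemma crd_secant_point z l : crd (secant_point z) l = (secant_map l).@[z].
Proof.
rewrite /secant_point crd_sum raddf_sum; apply: eq_bigr => i _ /=.
by rewrite crdZ of_crdK mevalM mevalXU meval_group.
Qed.

Lemma ev_secant_point f z : ev f (secant_point z) = (msubst secant_map f).@[z].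
Proof.
by rewrite /ev meval_msubst; apply: meval_eq => l; rewrite crd_secant_point.
Qed.

Lemma delta_prodP z :
  delta_prod.@[z] != 0 <-> forall i, delta.@[fun c => z (group_var i c)] != 0.
Proof.
rewrite /delta_prod rmorph_prod; split=> [/prodf_neq0 H i|H].
  by have := H i isT; rewrite /= meval_group.
by apply/prodf_neq0 => i _; rewrite /= meval_group.
Qed.

Lemma delta_prod_neq0 : delta_prod != 0.
Proof.
have [x dx] := mpoly_neq0_meval delta_neq0.
apply: contraTneq (_ : delta_prod.@[params (fun=> 0) (fun=> x)] != 0) => [->|].
  by rewrite meval0 eqxx.
apply/delta_prodP => i; rewrite (_ : meval _ _ = delta.@[x]) //.
by apply: meval_eq => c; rewrite params_group.
Qed.

Lemma secant_map_neq0 : exists l, secant_map l != 0.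
Proof.
have [x dx] := mpoly_neq0_meval delta_neq0.
have [l pl] : exists l, (psi l).@[x] != 0.
  apply: contrapT => nl; case/eqP: (orbit_point_neq0 dx); apply: crd_inj => l.
  rewrite of_crdK crd0; apply/eqP; apply: contrapT => pl; apply: nl.
  by exists l; apply/negP.
pose i0 := Ordinal s_gt0; exists l.
pose z := params (fun i => (i == i0)%:R) (fun=> x).
apply: contraNneq pl => /(congr1 (meval z)); rewrite meval0 => l0.
apply/eqP; rewrite -[RHS]l0 raddf_sum (bigD1 i0) //= big1 => [|i ii0].
  rewrite addr0 mevalM mevalXU /z params_scale eqxx mul1r meval_group.
  by apply: meval_eq => c; rewrite /z params_group.
by rewrite mevalM mevalXU /z params_scale (negbTE ii0) mul0r.
Qed.

Lemma deriv_scale i l : (secant_map l)^`M(scale_var i) =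
  msubst (fun c => 'X_(group_var i c)) (psi l).
Proof.
rewrite /secant_map raddf_sum (bigD1 i) //= [X in _ + X]big1 => [|k ki].
  rewrite addr0 mderivM mderiv_msubst big1 => [|c _].
    by rewrite mulr0 addr0 mderivXU eqxx mul1r.
  by rewrite mderivXU (inj_eq enum_rank_inj) xpair_eqE andbF mulr0.
rewrite mderivM mderiv_msubst big1 => [|c _].
  rewrite mulr0 addr0 mderivXU (inj_eq enum_rank_inj) xpair_eqE.
  by rewrite (negbTE ki) mul0r.
by rewrite mderivXU (inj_eq enum_rank_inj) xpair_eqE andbF mulr0.
Qed.

Lemma deriv_group i c l : (secant_map l)^`M(group_var i c) =
  'X_(scale_var i) * msubst (fun c => 'X_(group_var i c)) (psi l)^`M(c).
Proof.
have dX k d : ('X_(group_var k d) : {mpoly K[N]})^`M(group_var i c) =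
    ((k == i) && (d == c))%:R.
  by rewrite mderivXU (inj_eq enum_rank_inj) xpair_eqE.
have dS k : ('X_(scale_var k) : {mpoly K[N]})^`M(group_var i c) = 0.
  by rewrite mderivXU (inj_eq enum_rank_inj) xpair_eqE andbF.
rewrite /secant_map raddf_sum (bigD1 i) //= [X in _ + X]big1 => [|k ki].
  rewrite addr0 mderivM dS mul0r add0r mderiv_msubst (bigD1 c) //= big1.
    by rewrite addr0 dX !eqxx mulr1.
  by move=> d dc; rewrite dX (negbTE dc) andbF mulr0.
rewrite mderivM dS mul0r add0r mderiv_msubst big1 ?mulr0 // => d _.
by rewrite dX (negbTE ki) mulr0.
Qed.

Lemma orbit_params (P : 'I_s -> proj E) : (forall i, F (P i)) ->
  exists x, forall i, delta.@[x i] != 0 /\ line (P i) = <[orbit_point (x i)]>%VS.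
Proof.
move=> FP; have ex i : exists x, delta.@[x] != 0 /\ line (P i) = <[orbit_point x]>%VS.
  by have /F_orbit[x dx Px] := FP i; exists x.
by have [x xP] := choice ex; exists x.
Qed.

Lemma span_lines (P : 'I_s -> proj E) (p : 'I_s -> E) q :
  (forall i, line (P i) = <[p i]>%VS) -> q \in (\sum_(i < s) line (P i))%VS ->
  exists a : 'I_s -> K, q = \sum_i a i *: p i.
Proof.
move=> Pp /memv_sumP[u uP ->].
have ex i : exists c, u i = c *: p i.
  by have := uP i isT; rewrite Pp => /vlineP[c ->]; exists c.
by have [a aP] := choice ex; exists a; apply: eq_bigr => i _.
Qed.

Lemma secant_point_params a x :
  secant_point (params a x) = \sum_i a i *: orbit_point (x i).
Proof.
apply: eq_bigr => i _; rewrite params_scale; congr (_ *: _).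
apply: crd_inj => l; rewrite !of_crdK; apply: meval_eq => c.
exact: params_group.
Qed.

Lemma dim_vline1 (u : E) : u != 0 -> \dim <[u]>%VS == 1%N.
Proof. by rewrite dim_vline => ->. Qed.

Definition line_point (u : E) (u0 : u != 0) : proj E :=
  exist _ <[u]>%VS (dim_vline1 u0).

Lemma secant_point_in z (z0 : secant_point z != 0) :
  delta_prod.@[z] != 0 -> secant_variety s F (line_point z0).
Proof.
move=> /delta_prodP dz Z _ XZ; apply: XZ.
exists (fun i => line_point (orbit_point_neq0 (dz i))); split=> [i|].
  by apply/F_orbit; exists (fun c => z (group_var i c)).
rewrite /linear_span /= -memvE; apply: memv_sumr => i _.
by rewrite memvZ // memv_line.
Qed.

(** Multiplying by [delta_prod] and by a nonzero coordinate disposes of the parameters that give no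
    point of the secant variety; both factors are then cancelled. *)
Lemma cone_ideal_secant f :
  cone_ideal (secant_variety s F) f <-> msubst secant_map f = 0.
Proof.
split=> [If|f0 P XP v vP].
  have [l l0] := secant_map_neq0.
  suff : msubst secant_map f * (delta_prod * secant_map l) = 0.
    by move=> /eqP; rewrite !mulf_eq0 (negbTE l0) (negbTE delta_prod_neq0) !orbF => /eqP.
  apply: mpoly_meval_eq0 => z; rewrite !mevalM -ev_secant_point -crd_secant_point.
  have [->|dz] := eqVneq (delta_prod.@[z]) 0; first by rewrite mul0r mulr0.
  have [q0|q0] := eqVneq (secant_point z) 0; first by rewrite q0 crd0 !mulr0.
  rewrite (_ : ev f _ = 0) ?mul0r //.
  exact: (If _ (secant_point_in q0 dz) _ (memv_line _)).
pose Z : set (proj E) := fun P => forall v, v \in line P -> ev f v = 0.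
apply: (XP Z) vP => [|Q [P' [FP PQ]] w wQ].
  by exists (fun g => g = f) => P'; split=> [ZP g -> //|H v' v'P]; apply: H v'P.
have [x xP] := orbit_params FP.
have [a ->] := span_lines (fun i => (xP i).2) (subvP PQ _ wQ).
by rewrite -secant_point_params ev_secant_point f0 meval0.
Qed.

(* The scaling variables make this hold also when [a i = 0]: the derivative is
   divisible by the variable of [a i], which can be cancelled. *)
Lemma tangent_secant f (a : 'I_s -> K) x i j :
  msubst secant_map f = 0 -> (forall i, delta.@[x i] != 0) ->
  differential f (\sum_i a i *: orbit_point (x i)) (tau j (orbit_point (x i))) = 0.
Proof.
move=> f0 dx; have [b ->] := tau_velocity j (dx i).
pose S p := msubst (fun c => 'X_(group_var i c) : {mpoly K[N]}) p.
have vel c : differential f (\sum_i a i *: orbit_point (x i))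
    (orbit_velocity (x i) c) = 0.
  have : 'X_(scale_var i) * \sum_l msubst secant_map f^`M(l) * S (psi l)^`M(c) = 0.
    have D := mderiv_msubst secant_map f (group_var i c).
    rewrite f0 mderiv0 in D; rewrite [RHS]D mulr_sumr.
    by apply: eq_bigr => l _; rewrite deriv_group mulrCA.
  move/eqP; rewrite mulf_eq0 => /orP[/eqP X0|/eqP S0].
    have := congr1 (meval (fun=> 1)) X0; rewrite mevalXU meval0 => /eqP.
    by rewrite oner_eq0.
  have := congr1 (meval (params a x)) S0; rewrite meval0 raddf_sum /= => S1.
  rewrite -[RHS]S1.
  apply: eq_bigr => l _; rewrite mevalM -ev_secant_point secant_point_params.
  rewrite meval_group of_crdK; congr (_ * _); apply: meval_eq => d.
  by rewrite params_group.
rewrite /differential; under eq_bigr => l _ do rewrite crd_sum mulr_sumr.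
rewrite exchange_big big1 // => c _ /=.
transitivity (b c *
    differential f (\sum_i a i *: orbit_point (x i)) (orbit_velocity (x i) c)).
  rewrite /differential mulr_sumr; apply: eq_bigr => l _.
  by rewrite crdZ mulrCA.
by rewrite vel mulr0.
Qed.

(** The row space is T in coordinates. It is attached to representatives [v], and nonzero rescaling
    of these does not change it. *)
Definition tangent_mx (v : 'I_s -> E) : 'M[K]_(#|{: 'I_s * J}|, M) :=
  \matrix_(k, l) crd (tau (enum_val k).2 (v (enum_val k).1)) l.

Definition crow (w : E) : 'rV[K]_M := \row_l crd w l.

Lemma crow_linear : linear crow.
Proof. by move=> c u v; apply/rowP=> l; rewrite !mxE crdP. Qed.

HB.instance Definition _ := GRing.isLinear.Build K E 'rV[K]_M *:%R crow crow_linear.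

Lemma row_tangent_mx v i j :
  row (enum_rank (i, j)) (tangent_mx v) = crow (tau j (v i)).
Proof. by apply/rowP=> l; rewrite !mxE enum_rankK. Qed.

Lemma crow_tau_sub v i j : (crow (tau j (v i)) <= tangent_mx v)%MS.
Proof. by rewrite -row_tangent_mx row_sub. Qed.

Lemma tangent_mx_sub (v : 'I_s -> E) n' (A : 'M[K]_(n', M)) :
  (forall i j, crow (tau j (v i)) <= A)%MS -> (tangent_mx v <= A)%MS.
Proof.
move=> H; apply/row_subP => k; rewrite -[k]enum_valK.
by case: (enum_val k) => i j; rewrite row_tangent_mx.
Qed.

Lemma tangent_mx_functional v (eta : E -> K) (d : 'I_M -> K) :
  (forall u, eta u = \sum_l d l * crd u l) ->
  (forall i j, eta (tau j (v i)) = 0) ->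
  forall w, (crow w <= tangent_mx v)%MS -> eta w = 0.
Proof.
move=> etaE eta0 w /submxP[X wX]; pose dc : 'cV[K]_M := \col_l d l.
have etaM u : eta u = (crow u *m dc) 0 0.
  by rewrite etaE mxE; apply: eq_bigr => l _; rewrite !mxE mulrC.
suff Ad : tangent_mx v *m dc = 0 by rewrite etaM wX -mulmxA Ad mulmx0 mxE.
apply/row_matrixP => k; rewrite row_mul row0 -[k]enum_valK.
case: (enum_val k) => i j; rewrite row_tangent_mx.
by apply/matrixP=> i1 j1; rewrite !ord1 -etaM eta0 mxE.
Qed.

Lemma tauZ j c v : tau j (c *: v) = c *: tau j v.
Proof.
pose t : {linear E -> E} :=
  HB.pack (tau j) (GRing.isLinear.Build _ _ _ _ _ (tau_linear j)).
by rewrite -[LHS]/(t _) linearZ.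
Qed.

Lemma tangent_mx_scale (v : 'I_s -> E) c :
  (tangent_mx (fun i => c i *: v i)%R <= tangent_mx v)%MS.
Proof.
by apply: tangent_mx_sub => i j; rewrite tauZ linearZ scalemx_sub ?crow_tau_sub.
Qed.

Lemma tangent_mx_unscale (v : 'I_s -> E) c : (forall i, c i != 0) ->
  (tangent_mx v <= tangent_mx (fun i => c i *: v i)%R)%MS.
Proof.
move=> c0; apply: tangent_mx_sub => i j.
rewrite -[v i]scale1r -(mulVf (c0 i)) -scalerA tauZ linearZ scalemx_sub //.
exact: (crow_tau_sub (fun i => c i *: v i)).
Qed.

Local Notation group_part z i := (fun c => z (group_var i c)).

Lemma jacobian_tangent z : delta_prod.@[z] != 0 ->
  (jacobian_at secant_map z <= tangent_mx (fun i => orbit_point (group_part z i)))%MS.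
Proof.
move=> /delta_prodP dz; apply/row_subP => k; rewrite -[k]enum_valK.
case: (enum_val k) => i [c|].
  have -> : row (enum_rank (i, Some c)) (jacobian_at secant_map z) =
      z (scale_var i) *: crow (orbit_velocity (group_part z i) c).
    apply/rowP=> l; rewrite !mxE of_crdK -/(group_var i c) deriv_group mevalM mevalXU.
    by rewrite meval_group.
  have [a ->] := velocity_tau c (dz i); rewrite scalemx_sub // linear_sum.
  apply: summx_sub => j _; rewrite linearZ scalemx_sub //.
  exact: (crow_tau_sub (fun i => orbit_point (group_part z i))).
have -> : row (enum_rank (i, None)) (jacobian_at secant_map z) =
    crow (orbit_point (group_part z i)).
  apply/rowP=> l; rewrite !mxE of_crdK -/(scale_var i) deriv_scale.
  by rewrite meval_group.
have [a {1}->] := point_tau (dz i); rewrite linear_sum.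
apply: summx_sub => j _; rewrite linearZ scalemx_sub //.
exact: (crow_tau_sub (fun i => orbit_point (group_part z i))).
Qed.

(** The scalars are set to 1 because a zero scalar would kill the rows of velocities. With
    [jacobian_tangent] this compares the maximal rank of the Jacobian with the dimension of T. *)
Lemma tangent_jacobian x : (forall i, delta.@[x i] != 0) ->
  (tangent_mx (fun i => orbit_point (x i)) <=
   jacobian_at secant_map (params (fun=> 1) x))%MS.
Proof.
move=> dx; apply: tangent_mx_sub => i j; have [b ->] := tau_velocity j (dx i).
rewrite linear_sum; apply: summx_sub => c _; rewrite linearZ scalemx_sub //=.
rewrite (_ : crow _ =
  row (group_var i c) (jacobian_at secant_map (params (fun=> 1) x))).
  exact: row_sub.
apply/rowP=> l; rewrite !mxE of_crdK deriv_group mevalM mevalXU params_scale mul1r.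
by rewrite meval_group; apply: meval_eq => d; rewrite params_group.
Qed.

Lemma tangent_mx_form_linear i j : linear (fun v : {ffun 'I_s -> E} => tau j (v i)).
Proof. by move=> c u v; rewrite !ffunE tau_linear. Qed.

Lemma sum_linear : linear (fun v : {ffun 'I_s -> E} => \sum_i v i).
Proof.
move=> c u v; rewrite scaler_sumr -big_split; apply: eq_bigr => i _.
by rewrite !ffunE.
Qed.

(** The entries are linear forms on E^s, so that nonvanishing of a minor is a polynomial condition
    on tuples of representatives. *)
Definition tangent_form :
    'M[{mpoly K[ndim {ffun 'I_s -> E}]}]_(#|{: 'I_s * J}|, M) :=
  \matrix_(k, l) linear_form (fun v : {ffun 'I_s -> E} =>
    tau (enum_val k).2 (v (enum_val k).1)) l.

Lemma tangent_formE (v : {ffun 'I_s -> E}) :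
  map_mx (meval (crd v)) tangent_form = tangent_mx v.
Proof.
apply/matrixP=> k l; rewrite !mxE linear_formE //.
exact: tangent_mx_form_linear.
Qed.

(** T lies in the tangent space by [tangent_secant] and has dimension [r] where a minor survives;
    [tangent_bound] limits the tangent space to dimension [r] where [h] survives. A single parameter
    point shows that these open conditions can be met together. *)
Lemma general_tangent r (C : 'I_r -> 'I_N) (T : 'I_r -> 'I_M) :
  (forall z, \rank (jacobian_at secant_map z) <= r)%N ->
  \det (mxsub C T (jacobian secant_map)) != 0 ->
  general (@zariski_open_prod K E s) [set P | forall i, F (P i)]%classic
    (fun P => exists p, [/\ forall i, line (P i) = <[p i]>%VS,
      \rank (tangent_mx p) = r &
      general (@zariski_open K E) (linear_span P) (fun Q => forall w,
        affine_tangent (secant_variety s F) Q w <-> (crow w <= tangent_mx p)%MS)]).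
Proof.
move=> rmax dJ; have [h [h0 hT]] := tangent_bound rmax dJ.
have [l0 Fl0] := secant_map_neq0.
pose D := \det (mxsub C T (jacobian secant_map)).
(* One nonzero product yields a point [z] satisfying everything at once: nonzero scalars allow
   [tangent_mx_unscale], and [l0] keeps the secant point away from 0. *)
pose big := D * (delta_prod * ((\prod_i 'X_(scale_var i)) *
  (msubst secant_map h * secant_map l0))).
have big0 : big != 0.
  rewrite !mulf_neq0 ?delta_prod_neq0 //; apply/prodf_neq0 => i _.
  by rewrite -msize_poly_eq0 msizeX.
have [z] := mpoly_neq0_meval big0; rewrite !mevalM !mulf_eq0 !negb_or.
case/and5P=> Dz dz az hz lz.
pose v : {ffun 'I_s -> E} :=
  [ffun i => z (scale_var i) *: orbit_point (group_part z i)].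
have vE : tangent_mx v =
    tangent_mx (fun i => z (scale_var i) *: orbit_point (group_part z i)).
  by congr tangent_mx; apply/funext => i; rewrite ffunE.
have az' i : z (scale_var i) != 0.
  move: az; rewrite rmorph_prod /= => /prodf_neq0/(_ i isT).
  by rewrite mevalXU.
have rv : (r <= \rank (tangent_mx v))%N.
  apply: leq_trans (_ : \rank (jacobian_at secant_map z) <= _)%N.
    apply: (@rank_ge_minor _ _ _ _ _ C T).
    by rewrite -map_mxsub det_map_mx.
  apply: mxrankS; apply: submx_trans (jacobian_tangent dz) _; rewrite vE.
  exact: tangent_mx_unscale.
have [f [g dfg]] : exists (f : 'I_r -> 'I_#|{: 'I_s * J}|) (g : 'I_r -> 'I_M),
    \det (mxsub f g (tangent_mx v)) != 0.
  have [f [g [_ _ dfg]]] := mxminor_rank (tangent_mx v).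
  have rr : \rank (tangent_mx v) = r.
    apply/eqP; rewrite eqn_leq rv andbT.
    apply: leq_trans (rmax (params (fun=> 1) (fun i => group_part z i))).
    apply: mxrankS; apply: submx_trans (tangent_jacobian _); last exact/delta_prodP.
    rewrite vE; exact: tangent_mx_scale.
  by move: f g dfg; rewrite rr => f g dfg; exists f, g.
(* The sum of the representatives is a point of the span. Imposing [h] on it guarantees that the
   second open set meets the span of every tuple in the first; ['X_l0] excludes a zero sum. *)
pose G := \det (mxsub f g tangent_form) *
  msubst (linear_form (fun v : {ffun 'I_s -> E} => \sum_i v i)) (h * 'X_l0).
have GE (u : {ffun 'I_s -> E}) :
    ev G u = \det (mxsub f g (tangent_mx u)) * ev (h * 'X_l0) (\sum_i u i).
  rewrite /ev mevalM -det_map_mx map_mxsub tangent_formE; congr (_ * _).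
  exact: (ev_linear_pullback sum_linear).
pose O : set ('I_s -> proj E) := fun P => exists2 u : {ffun 'I_s -> E},
  forall i, u i \in line (P i) & ev G u != 0.
exists O; split.
- exists (fun f => f = G) => P; split=> [nO _ -> u uP|H [u uP]].
    by apply/eqP; apply: contrapT => Gu; apply: nO; exists u => //; apply/negP.
  by rewrite (H G erefl) ?eqxx.
- have /delta_prodP dz' := dz.
  exists (fun i => line_point (orbit_point_neq0 (dz' i))); split=> [i|].
    by apply/F_orbit; exists (group_part z i).
  exists v => [i|]; first by rewrite ffunE /= memvZ ?memv_line.
  rewrite GE mulf_neq0 // (_ : \sum_i v i = secant_point z).
    by rewrite ev_secant_point rmorphM /= mevalM msubstX mulf_neq0.
  by apply: eq_bigr => i _; rewrite ffunE.
move=> P FP [u uP]; rewrite GE mulf_eq0 negb_or => /andP[du hu].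
have [x xP] := orbit_params FP; pose p i := orbit_point (x i).
have dx i : delta.@[x i] != 0 by case: (xP i).
have Pp i : line (P i) = <[p i]>%VS by case: (xP i).
have [c cP] : exists c : 'I_s -> K, forall i, u i = c i *: p i.
  have ex i : exists c, u i = c *: p i.
    by have := uP i; rewrite Pp => /vlineP[c ->]; exists c.
  by have [c cP] := choice ex; exists c.
have rp : \rank (tangent_mx p) = r.
  apply/eqP; rewrite eqn_leq (leq_trans (mxrankS (tangent_jacobian dx)) (rmax _)) /=.
  apply: leq_trans (rank_ge_minor du) _; apply: mxrankS.
  rewrite (_ : tangent_mx u = tangent_mx (fun i => c i *: p i)).
    exact: tangent_mx_scale.
  by congr tangent_mx; apply/funext.
exists p; split=> //.
pose O' : set (proj E) :=
  fun Q => exists2 q, q \in line Q & ev (h * 'X_l0) q != 0.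
have q0 : \sum_i u i != 0.
  apply: contraNneq hu => ->; rewrite /ev mevalM mevalXU.
  by rewrite crd0 mulr0.
exists O'; split.
- exists (fun f => f = h * 'X_l0) => Q; split=> [nO _ -> q qQ|H [q qQ]].
    by apply/eqP; apply: contrapT => Gu; apply: nO; exists q => //; apply/negP.
  by rewrite (H _ erefl) ?eqxx.
- exists (line_point q0); split; last by exists (\sum_i u i); rewrite ?memv_line.
  rewrite /linear_span /= -memvE; apply: memv_sumr => i _; exact: uP.
move=> Q QP [q qQ hq].
have tp q' f' i j : q' \in line Q -> cone_ideal (secant_variety s F) f' ->
    differential f' q' (tau j (p i)) = 0.
  move=> q'Q /cone_ideal_secant f'0.
  have [a ->] := span_lines Pp (subvP QP _ q'Q).
  exact: tangent_secant.
have tpA q' f' w : q' \in line Q -> cone_ideal (secant_variety s F) f' ->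
    (crow w <= tangent_mx p)%MS -> differential f' q' w = 0.
  move=> q'Q If'.
  apply: (@tangent_mx_functional p (differential f' q')
    (fun l => ev f'^`M(l) q')) => //.
  by move=> i j; apply: tp.
move=> w; split=> [tw|wA q' q'Q _ f' If']; last exact: tpA.
have hq' : h.@[crd q] != 0.
  by move: hq; rewrite /ev mevalM mulf_eq0 negb_or => /andP[].
have qn0 : q != 0.
  apply: contraNneq hq => ->; rewrite /ev mevalM mevalXU.
  by rewrite crd0 mulr0.
pose A := tangent_mx p.
have key w' : affine_tangent (secant_variety s F) Q w' ->
    (forall k, crd w' (T k) = 0) -> w' = 0.
  move=> tw' w'T; apply: crd_inj => l; rewrite crd0.
  apply: (hT (crd q) (crd w')) => // f' /cone_ideal_secant If'.
  exact: tw'.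
have crowK (y : 'rV_M) : crow (of_crd (fun l => y 0 l)) = y.
  by apply/rowP=> l; rewrite mxE of_crdK.
(* Combinations of rows of [A] are tangent vectors, so by [key] they vanish once their
   [T]-coordinates do: restriction to [T] is injective on the row space. *)
have kerA : (kermx (colsub T A) <= kermx A)%MS.
  apply/row_subP => k; apply/sub_kermxP.
  set y := row k _; have yT : y *m colsub T A = 0.
    by rewrite -row_mul mulmx_ker row0.
  pose w' : E := of_crd (fun l => (y *m A) 0 l).
  have w'A : crow w' = y *m A by rewrite crowK.
  have : w' = 0.
    apply: key => [q' q'Q _ f' If'|k'].
      by apply: tpA => //; rewrite w'A submxMl.
    rewrite of_crdK; have /matrixP/(_ 0 k') := yT.
    by rewrite mulmx_colsub !mxE.
  by rewrite -w'A => ->; rewrite linear0.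
have full : row_full (colsub T A).
  rewrite /row_full eqn_leq rank_leq_col /=; have := mxrankS kerA.
  rewrite !mxrank_ker leqNgt => H; rewrite leqNgt; apply/negP.
  rewrite -[X in (_ < X)%N]rp => lt.
  case/negP: H; apply: (ltn_sub2l _ lt); exact: leq_trans lt (rank_leq_row _).
(* Since the row space has dimension [r], restriction to [T] is also surjective. Some combination of
   rows has the [T]-coordinates of [w], and [key] kills the difference. *)
have /submxP[y yw] : (\row_k crd w (T k) <= colsub T A)%MS by apply: submx_full.
pose w' := w - of_crd (fun l => (y *m A) 0 l).
have w'0 : w' = 0.
  apply: key => [q' q'Q q'0 f' If'|k].
    have dB : differential f' q' w' = differential f' q' w -
        differential f' q' (of_crd (fun l => (y *m A) 0 l)).
      rewrite /differential -sumrB; apply: eq_bigr => l _.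
      by rewrite /w' -mulrBr /crd linearB.
    rewrite dB tw // tpA ?subrr // crowK; exact: submxMl.
  have /matrixP/(_ 0 k) := yw; rewrite mulmx_colsub !mxE => wk.
  by rewrite /w' /crd linearB /= -/(crd _ _) -/(crd _ _) of_crdK wk mxE subrr.
by move/eqP: w'0; rewrite subr_eq0 => /eqP ->; rewrite crowK submxMl.
Qed.

(** Of [r.+1] coordinates independent on the cone, the last serves as denominator for the others;
    homogenizing turns a polynomial in the quotients into one in all [r.+1] coordinates. *)
Lemma alg_indep_secant_lower r (C : 'I_r.+1 -> 'I_N) (T : 'I_r.+1 -> 'I_M) :
  \det (mxsub C T (jacobian secant_map)) != 0 ->
  alg_indep_functions (secant_variety s F) r.
Proof.
move=> dJ; exists 1%N, 'X_(T ord_max), (fun i => 'X_(T (lift ord_max i))).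
split=> [|i|G G0]; rewrite ?dhomogX /= ?mdeg1 //.
have [H [H0 HG]] := homogenization G0.
have : msubst (fun k => secant_map (T k)) ('X_ord_max * H) * delta_prod != 0.
  rewrite mulf_neq0 ?delta_prod_neq0 //.
  apply: contra_neq (_ : 'X_ord_max * H != 0) => [|].
    exact: (jacobian_independent dJ).
  by rewrite mulf_neq0 // -msize_poly_eq0 msizeX.
move=> /mpoly_neq0_meval[z]; rewrite mevalM mulf_eq0 negb_or => /andP[Hz dz].
move: Hz; rewrite meval_msubst mevalM mevalXU mulf_eq0 negb_or => /andP[Tz Hz].
have qE l : crd (secant_point z) l = (secant_map l).@[z] by apply: crd_secant_point.
have q0 : secant_point z != 0.
  by apply: contraNneq Tz => q0; rewrite -qE q0 crd0.
exists (line_point q0), (secant_point z); split.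
- exact: secant_point_in.
- exact: memv_line.
- by rewrite /ev mevalXU qE.
- have := HG _ Tz Hz; congr (_ != _); apply: meval_eq => i.
  by rewrite /ev !mevalXU !qE.
Qed.

(* A relation between the homogeneous forms [g], [f i] holds on a cone, so it can
   be dehomogenized by rescaling, taking [e]-th roots. *)
Lemma alg_indep_secant_upper r d : (0 < r)%N ->
  (forall z, \rank (jacobian_at secant_map z) <= r)%N ->
  alg_indep_functions (secant_variety s F) d -> (d < r)%N.
Proof.
move=> r_gt0 rmax [e [g [f [ge fe ind]]]]; rewrite ltnNge; apply/negP => rd.
have evc e' (k : {mpoly K[M]}) c v :
    k \is e'.-homog -> ev k (c *: v) = c ^+ e' * ev k v.
  move=> ke; rewrite /ev -homog_meval //; apply: meval_eq => i.
  by rewrite crdZ.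
(* In degree 0 all quotients are constant, so one of them already satisfies a linear relation; there
   is one because [d >= r > 0]. *)
have [e0|e_gt0] := posnP e.
  rewrite e0 in ge fe; pose i0 : 'I_d := Ordinal (leq_trans r_gt0 rd).
  have ev0 (k : {mpoly K[M]}) v : k \is 0.-homog -> ev k v = ev k 0.
    move=> k0; have := evc 0%N k 0 v k0.
    by rewrite scale0r expr0 mul1r.
  have [|P [v [_ _ _]]] := ind ('X_i0 - (ev (f i0) 0 / ev g 0)%:MP).
    apply/eqP => /(congr1 (mcoeff U_(i0)%MM)).
    rewrite mcoeffB mcoeffXU eqxx mcoeffC mnm1_eq0 mulr0 subr0 mcoeff0.
    exact/eqP/oner_neq0.
  by rewrite mevalB mevalXU mevalC !(ev0 _ v) // subrr eqxx.
pose y k := oapp f g (unlift (@ord_max d) k).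
have yM : y ord_max = g by rewrite /y unlift_none.
have yl i : y (lift ord_max i) = f i by rewrite /y liftK.
have ye k : y k \is e.-homog.
  by case: (unliftP ord_max k) => [i ->|->]; rewrite ?yl ?yM.
have [z|p [p0 yp]] := @jacobian_relation _ _ _ (fun k => msubst secant_map (y k)).
  by rewrite ltnS (leq_trans (rank_jacobian_msubst _ _ _)) // (leq_trans (rmax z)).
have Ip : cone_ideal (secant_variety s F) (msubst y p).
  by apply/cone_ideal_secant; rewrite msubst_comp.
(* The extra variable makes the last coordinate [b] of the test point nonzero, so the other
   coordinates can be divided by it. *)
have pX0 : 'X_ord_max * p != 0 by rewrite mulf_neq0 // -msize_poly_eq0 msizeX.
have [w] := mpoly_neq0_meval pX0; rewrite mevalM mevalXU mulf_eq0 negb_or.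
move=> /andP[wM wp]; pose b := w ord_max.
pose G : {mpoly K[d]} :=
  msubst (fun k => b *: oapp (fun i => 'X_i) 1 (unlift (@ord_max d) k)) p.
have GE x : G.@[x] = p.@[fun k => b * oapp x 1 (unlift (@ord_max d) k)].
  rewrite meval_msubst; apply: meval_eq => k; rewrite mevalZ.
  by case: unlift => [i|] /=; rewrite ?mevalXU ?meval1.
have G0 : G != 0.
  apply: contraNneq wp => G0; have := GE (fun i => w (lift ord_max i) / b).
  rewrite G0 meval0 => pw; apply/eqP; rewrite [RHS]pw; apply: meval_eq => k.
  case: (unliftP ord_max k) => [i ->|->]; rewrite ?liftK ?unlift_none /= ?mulr1 //.
  by rewrite mulrCA divff // mulr1.
have [P [v [XP vP gv]]] := ind _ G0; rewrite GE; apply/negP; rewrite negbK.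
pose c := e.-root (b / ev g v).
have ce : c ^+ e = b / ev g v by apply: rootCK.
have := Ip _ XP (c *: v) (memvZ c vP); rewrite /ev meval_msubst => pc.
apply/eqP; rewrite -[RHS]pc; apply: meval_eq => k.
rewrite -/(ev (y k) (c *: v)) (evc e) // ce.
case: (unliftP ord_max k) => [i ->|->]; rewrite ?liftK ?unlift_none ?yl ?yM /=.
  by rewrite mulrA mulrAC.
by rewrite mulr1 divfK.
Qed.

Lemma secant_proj_dim r (C : 'I_r -> 'I_N) (T : 'I_r -> 'I_M) :
  (forall z, \rank (jacobian_at secant_map z) <= r)%N ->
  \det (mxsub C T (jacobian secant_map)) != 0 ->
  (0 < r)%N /\ proj_dim (secant_variety s F) = r.-1.
Proof.
move=> rmax dJ.
have r_gt0 : (0 < r)%N.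
  (* At rank 0 the derivatives in the scaling variables, which are the coordinates of orbit points,
     would vanish. *)
  rewrite lt0n; apply/negP => /eqP r0.
  have [x dx] := mpoly_neq0_meval delta_neq0.
  pose z := params (fun=> 1) (fun=> x); pose i0 := Ordinal s_gt0.
  have J0 : jacobian_at secant_map z = 0.
    by apply/eqP; rewrite -mxrank_eq0 -leqn0 -[X in (_ <= X)%N]r0.
  case/eqP: (orbit_point_neq0 dx); apply: crd_inj => l.
  rewrite of_crdK crd0; have /matrixP/(_ (scale_var i0) l) := J0.
  rewrite !mxE deriv_scale meval_group => pl; rewrite -[RHS]pl.
  by apply: meval_eq => c; rewrite /z params_group.
split=> //; case: r C T rmax dJ r_gt0 => // r C T rmax dJ _ /=.
(* The maximum in [proj_dim] runs only up to [ndim E]. *)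
have rM : (r < M.+1)%N.
  have [z Dz] := mpoly_neq0_meval dJ.
  rewrite -det_map_mx map_mxsub in Dz.
  have := leq_trans (rank_ge_minor Dz) (rank_leq_col _); exact: ltnW.
apply/eqP; rewrite eqn_leq /proj_dim; apply/andP; split.
  apply/bigmax_leqP => d /asboolP ind.
  by rewrite -ltnS; apply: alg_indep_secant_upper ind.
apply: (bigop.bigmax_sup (Ordinal rM)) => //; apply/asboolP.
exact: (alg_indep_secant_lower dJ).
Qed.

Theorem terracini : exists r, [/\ (0 < r)%N,
  proj_dim (secant_variety s F) = r.-1 &
  general (@zariski_open_prod K E s) [set P | forall i, F (P i)]%classic
    (fun P => exists p, [/\ forall i, line (P i) = <[p i]>%VS,
      \rank (tangent_mx p) = r &
      general (@zariski_open K E) (linear_span P) (fun Q => forall w,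
        affine_tangent (secant_variety s F) Q w <-> (crow w <= tangent_mx p)%MS)])].
Proof.
have [r [rmax [z0 rz0]]] := jacobian_max secant_map.
have [C [T [_ _ dz0]]] := mxminor_rank (jacobian_at secant_map z0).
rewrite rz0 in C T dz0; have dJ := det_jacobian_neq0 dz0.
exists r; have [r0 rd] := secant_proj_dim rmax dJ; split=> //.
exact: general_tangent dJ.
Qed.

End Terracini.

(** * Secant varieties of flag varieties *)

Section Derivations.

Variables (R A : comNzRingType) (D : A -> A).
Hypothesis D_mul : forall a b, D (a * b) = D a * b + a * D b.

Lemma derivation_prod (I : finType) (F : I -> A) :
  D (\prod_i F i) = \sum_i D (F i) * \prod_(j | j != i) F j.
Proof.
have D1 : D 1 = 0.
  by apply: (addrI (D 1)); rewrite addr0; have := D_mul 1 1; rewrite !mulr1 mul1r.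
have gen (r : seq I) : uniq r ->
    D (\prod_(i <- r) F i) = \sum_(i <- r) D (F i) * \prod_(j <- r | j != i) F j.
  elim: r => [_|x r IHr /= /andP[xr ur]]; first by rewrite !big_nil.
  rewrite !big_cons D_mul IHr // eqxx /=; congr (_ * _ + _).
    rewrite [in RHS]big_seq_cond [LHS]big_seq; apply: eq_bigl => j.
    by case jr: (j \in r) => //=; apply/esym; apply: contraNneq xr => <-.
  rewrite mulr_sumr [LHS]big_seq [RHS]big_seq; apply: eq_bigr => i ir.
  have xi : x != i by apply: contraNneq xr => ->.
  by rewrite [in RHS]big_cons xi mulrCA.
by rewrite gen // index_enum_uniq.
Qed.

End Derivations.

Section OrbitMap.

Variables (K : numFieldType) (n : nat) (D : seq (nat * nat)).
Implicit Types (t u w : tens K n D) (g xi : 'M[K]_n) (f k : filling n D).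

(** The derivative at [g], in direction [xi], of the map sending [g] to [act g u]. *)
Definition dact g xi u : tens K n D :=
  [ffun f : filling n D => \sum_(k : filling n D)
     (\sum_x xi (f x) (k x) * \prod_(y | y != x) g (f y) (k y)) * u k].

Lemma dact_linear g u : linear (fun xi => dact g xi u).
Proof.
move=> c xi eta; apply/ffunP=> f; rewrite tensD tensZ !ffunE mulr_sumr -big_split.
apply: eq_bigr => k _ /=; rewrite mulrA -mulrDl mulr_sumr -big_split; congr (_ * _).
by apply: eq_bigr => x _; rewrite !mxE mulrDl mulrA.
Qed.

Lemma dact_sum_delta g xi u :
  dact g xi u = \sum_i \sum_j xi i j *: dact g (delta_mx i j) u.
Proof.
pose l : {linear 'M[K]_n -> tens K n D} := HB.pack (fun xi => dact g xi u)
  (GRing.isLinear.Build K 'M[K]_n (tens K n D) *:%R _ (dact_linear g u)).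
rewrite {1}[xi]matrix_sum_delta -[LHS]/(l _) linear_sum; apply: eq_bigr => i _.
by rewrite linear_sum; apply: eq_bigr => j _; rewrite linearZ.
Qed.

(** The direction [xi *m g] at [g] is the velocity of (1 + t xi) g, so derivatives at any invertible
    [g] become infinitesimal actions on the moved tensor. *)
Lemma dact_lie g xi u : dact g (xi *m g) u = lie xi (act g u).
Proof.
apply/ffunP=> f; rewrite !ffunE.
under eq_bigr => k _ do rewrite mulr_suml.
rewrite exchange_big; apply: eq_bigr => x _ /=.
under [RHS]eq_bigr => j _ do rewrite ffunE mulr_sumr.
rewrite exchange_big; apply: eq_bigr => k _ /=.
rewrite mxE !mulr_suml; apply: eq_bigr => j _.
rewrite -!mulrA; congr (_ * _); rewrite mulrA; congr (_ * _).
rewrite [RHS](bigD1 x) //= ffunE eqxx; congr (_ * _); apply: eq_bigr => y yx.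
by rewrite ffunE (negbTE yx).
Qed.

Lemma lie1 u : lie 1%:M u = #|{: seq_sub D}|%:R *: u.
Proof.
apply/ffunP=> f; rewrite tensZ ffunE mulr_natl -sumr_const.
apply: eq_bigr => x _; rewrite (bigD1 (f x)) //= big1 => [|j jf].
  rewrite mxE eqxx mul1r addr0; congr (u _); apply/ffunP=> z; rewrite ffunE.
  by case: eqP => [->|].
by rewrite mxE eq_sym (negbTE jf) mul0r.
Qed.

Local Notation m := #|{: 'I_n * 'I_n}|.

Definition mx_of_params (x : 'I_m -> K) : 'M[K]_n :=
  \matrix_(i, j) x (enum_rank (i, j)).

Definition params_of_mx g (c : 'I_m) : K := g (enum_val c).1 (enum_val c).2.

Lemma params_of_mxK g : mx_of_params (params_of_mx g) = g.
Proof. by apply/matrixP=> i j; rewrite mxE /params_of_mx enum_rankK. Qed.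

Definition generic_mx : 'M[{mpoly K[m]}]_n := \matrix_(i, j) 'X_(enum_rank (i, j)).

Lemma meval_det_generic x : (\det generic_mx).@[x] = \det (mx_of_params x).
Proof.
rewrite -det_map_mx; congr (\det _); apply/matrixP=> i j.
by rewrite !mxE /= mevalXU.
Qed.

Lemma det_generic_neq0 : \det generic_mx != 0.
Proof.
apply: contraTneq (_ : (\det generic_mx).@[params_of_mx 1%:M] != 0) => [->|].
  by rewrite meval0 eqxx.
by rewrite meval_det_generic params_of_mxK det1 oner_neq0.
Qed.

Definition orbit_poly w u : {mpoly K[m]} :=
  \sum_f w f *: \sum_k u k *: \prod_x generic_mx (f x) (k x).

Lemma orbit_polyE w u x :
  (orbit_poly w u).@[x] = dot w (act (mx_of_params x) u).
Proof.
rewrite /orbit_poly raddf_sum; apply: eq_bigr => f _.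
rewrite /= mevalZ raddf_sum ffunE; congr (_ * _); apply: eq_bigr => k _.
rewrite /= mevalZ rmorph_prod mulrC; congr (_ * _); apply: eq_bigr => y _.
by rewrite /= !mxE mevalXU.
Qed.

Lemma mderiv_orbit_poly w u c x : (orbit_poly w u)^`M(c).@[x] =
  dot w (dact (mx_of_params x) (delta_mx (enum_val c).1 (enum_val c).2) u).
Proof.
rewrite /orbit_poly (raddf_sum (mderiv c)) (raddf_sum (meval x)) /=.
apply: eq_bigr => f _.
rewrite mderivZ mevalZ ffunE; congr (_ * _).
rewrite (raddf_sum (mderiv c)) (raddf_sum (meval x)) /=; apply: eq_bigr => k _.
rewrite mderivZ mevalZ mulrC; congr (_ * _).
rewrite (derivation_prod (@mderivM _ _ c)) (raddf_sum (meval x)) /=.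
apply: eq_bigr => y _; rewrite mevalM rmorph_prod /=; congr (_ * _).
  rewrite !mxE mderivXU -[c in _ == c]enum_valK (inj_eq enum_rank_inj).
  rewrite [enum_val c]surjective_pairing xpair_eqE /=.
  by case: andP => _; rewrite ?meval1 ?meval0.
by apply: eq_bigr => z _; rewrite !mxE mevalXU.
Qed.

Lemma scalar_dot (phi : tens K n D -> K) : linear_for *%R phi ->
  exists w, forall t, phi t = dot w t.
Proof.
move=> phi_lin; pose l : {linear tens K n D -> K | *%R} :=
  HB.pack phi (GRing.isLinear.Build K (tens K n D) K *%R phi phi_lin).
pose e k : tens K n D := [ffun f => (f == k)%:R].
exists [ffun k => phi (e k)] => t.
have -> : phi t = \sum_k t k * phi (e k).
  rewrite -[phi]/(l : _ -> _) -[in LHS](_ : \sum_k t k *: e k = t).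
    by rewrite linear_sum; apply: eq_bigr => k _; rewrite linearZ.
  apply/ffunP=> f; rewrite sum_ffunE (bigD1 f) //= big1 => [|k kf].
    by rewrite tensZ ffunE eqxx mulr1 addr0.
  by rewrite tensZ ffunE eq_sym (negbTE kf) mulr0.
by apply: eq_bigr => k _; rewrite ffunE mulrC.
Qed.

(** The part of [act g u] outside [S] is polynomial in the entries of [g] and vanishes on invertible
    matrices, hence identically; so do its derivatives at the identity. *)
Lemma gl_stable_lie (S : {vspace tens K n D}) xi u :
  gl_stable S -> u \in S -> lie xi u \in S.
Proof.
move=> Sst uS; pose rho t := t - projv S t.
suff -> : lie xi u = projv S (lie xi u) by apply: memv_proj.
apply/eqP; rewrite -subr_eq0; apply/eqP/ffunP=> f; rewrite [RHS]ffunE -/(rho _).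
have rho_lin : linear rho.
  by move=> c t t'; rewrite /rho linearP scalerBr opprD addrACA.
have [|w wE] := @scalar_dot (fun t => rho t f).
  by move=> c t t'; rewrite rho_lin tensD tensZ.
rewrite wE; have p0 : orbit_poly w u = 0.
  apply/eqP; have : orbit_poly w u * \det generic_mx = 0.
    apply: mpoly_meval_eq0 => x; rewrite mevalM orbit_polyE meval_det_generic -wE.
    have [->|dx] := eqVneq (\det (mx_of_params x)) 0; first by rewrite mulr0.
    have aS : act (mx_of_params x) u \in S by apply: Sst; rewrite // unitmxE unitfE.
    by rewrite /rho projv_id // subrr ffunE mul0r.
  by move/eqP; rewrite mulf_eq0 (negbTE det_generic_neq0) orbF.
rewrite -[u]act1 -dact_lie mulmx1 dact_sum_delta linear_sum big1 // => i _.
rewrite linear_sum big1 // => j _; rewrite linearZ /=.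
have := mderiv_orbit_poly w u (enum_rank (i, j)) (params_of_mx 1%:M).
by rewrite p0 mderiv0 meval0 params_of_mxK enum_rankK /= => <-; rewrite mulr0.
Qed.

End OrbitMap.

Lemma general_imply (T : Type) (op : set (set T)) (Z : set T) (Phi Psi : T -> Prop) :
  (forall x, Z x -> Phi x -> Psi x) -> general op Z Phi -> general op Z Psi.
Proof.
by move=> PhiPsi [O [opO ZO H]]; exists O; split=> // x Zx Ox; apply/PhiPsi/H.
Qed.

Lemma dim_eq_rank (K : fieldType) (V : vectType K) (U : {vspace V}) k M
    (co : {linear V -> 'rV[K]_M}) (B : 'M[K]_(k, M)) :
  (forall u, u \in U -> co u = 0 -> u = 0) ->
  (forall u, u \in U -> (co u <= B)%MS) ->
  (forall i, exists2 u, u \in U & co u = row i B) -> \dim U = \rank B.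
Proof.
move=> co_inj coB Bco; pose e := vbasis U.
pose Me : 'M[K]_(\dim U, M) := \matrix_i co e`_i.
have eU (i : 'I_(\dim U)) : e`_i \in U.
  by apply: vbasis_mem; rewrite mem_nth // size_tuple.
have comb (y : 'rV[K]_(\dim U)) : y *m Me = co (\sum_i y 0 i *: e`_i).
  rewrite linear_sum mulmx_sum_row; apply: eq_bigr => i _.
  by rewrite linearZ rowK.
have MeB : (Me <= B)%MS by apply/row_subP => i; rewrite rowK coB.
have BMe : (B <= Me)%MS.
  apply/row_subP => i; have [u uU <-] := Bco i.
  rewrite (coord_vbasis uU); apply/submxP; exists (\row_i coord e i u).
  by rewrite comb; congr (co _); apply: eq_bigr => j _; rewrite mxE.
have free : row_free Me.
  rewrite -kermx_eq0; apply/eqP/row_matrixP => i; rewrite row0.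
  set y := row i _; have : y *m Me = 0 by rewrite -row_mul mulmx_ker row0.
  rewrite comb => /co_inj y0; apply/rowP=> j; rewrite [RHS]mxE.
  have /freeP/(_ (fun l => y 0 l)) ff := basis_free (vbasisP U); apply: ff.
  by apply: y0; apply: memv_suml => l _; apply: memvZ.
have <- : \rank Me = \dim U by apply/eqP.
by apply/eqP; rewrite eqn_leq !mxrankS.
Qed.

Lemma vsval_inj (K : fieldType) (V : vectType K) (U : {vspace V}) :
  injective (@vsval K V U).
Proof. exact: val_inj. Qed.

Lemma vsvalZ (K : fieldType) (V : vectType K) (U : {vspace V}) c (u : subvs_of U) :
  vsval (c *: u) = c *: vsval u.
Proof. exact: linearZ. Qed.

Lemma vsval_sum (K : fieldType) (V : vectType K) (U : {vspace V}) (I : Type)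
    (r : seq I) (P : pred I) (F : I -> subvs_of U) :
  vsval (\sum_(i <- r | P i) F i) = \sum_(i <- r | P i) vsval (F i).
Proof. exact: linear_sum. Qed.

(** * Tangent spaces and annihilators inside the Schur module *)

Section SchurSecants.

Variables (K : numClosedFieldType) (n : nat) (la : seq nat).
Hypothesis la_part : is_partition la.
Hypothesis la_size : (size la <= n)%N.
Hypothesis la_neq0 : la <> [::].

Local Notation D := (diagram la).
Local Notation S := (schur K n la).
Local Notation E := (schur_space K n la).
Local Notation hv := (highest_tensor K (diagram_rows la_size)).

Lemma schur_act g t : g \in unitmx -> t \in S -> act g t \in S.
Proof.
by move=> gU tS; have [_ Sst _ _] := schurP K la_part la_size; apply: Sst.
Qed.

Lemma schur_lie_mem xi t : t \in S -> lie xi t \in S.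
Proof. by apply: gl_stable_lie => g u; apply: schur_act. Qed.

Definition schur_lie (ij : 'I_n * 'I_n) (u : E) : E :=
  vsproj S (lie (delta_mx ij.1 ij.2) (vsval u)).

Lemma vsval_schur_lie ij u :
  vsval (schur_lie ij u) = lie (delta_mx ij.1 ij.2) (vsval u).
Proof. by rewrite vsprojK // schur_lie_mem // subvsP. Qed.

Lemma schur_lie_linear ij : linear (schur_lie ij).
Proof. by move=> c u v; rewrite /schur_lie !linearP. Qed.

Lemma lie_schur_lie xi u :
  lie xi (vsval u) = \sum_ij xi ij.1 ij.2 *: vsval (schur_lie ij u).
Proof.
rewrite lie_sum_delta pair_bigA; apply: eq_bigr => ij _ /=.
by rewrite vsval_schur_lie.
Qed.

(** The identity matrix acts by this scalar, which has to be inverted to recover a point from its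
    image under gl(V). *)
Lemma card_cells_neq0 : #|{: seq_sub D}|%:R != 0 :> K.
Proof.
rewrite pnatr_eq0 card_seq_sub ?diagram_uniq // -lt0n.
rewrite (@leq_trans 1) // -has_predT; apply/hasP.
have [l0 zla] := andP la_part.
exists (0, 0)%N => //; rewrite mem_diagram; case: la la_neq0 zla => //= a r _.
by rewrite in_cons negb_or lt0n eq_sym => /andP[].
Qed.

Lemma dot_lie_all phi (u : E) :
  (dot phi (vsval u) = 0 /\ forall xi, dot phi (lie xi (vsval u)) = 0) <->
  forall ij, dot phi (vsval (schur_lie ij u)) = 0.
Proof.
split=> [[_ H] ij|H]; first by rewrite vsval_schur_lie.
have Hxi xi : dot phi (lie xi (vsval u)) = 0.
  rewrite lie_schur_lie linear_sum big1 // => ij _.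
  by rewrite linearZ /= H mulr0.
split=> //; have := Hxi 1%:M; rewrite lie1 linearZ /= => /eqP.
by rewrite mulf_eq0 (negbTE card_cells_neq0) => /eqP.
Qed.

Lemma flag_orbit (P : proj E) : flag_variety P <->
  exists2 g : 'M[K]_n, g \in unitmx & line P = <[vsproj S (act g hv)]>%VS.
Proof.
have hS := highest_tensor_schur K la_part la_size.
split=> [[v [g [p [hwv gU pE Pp]]]]|[g gU Pg]].
  have [alt _ _ _] := schurP K la_part la_size.
  have := highest_weight_unique la_part la_size (alt _ (subvsP v)) hwv.
  set c := _ (row_filling _) => vE; exists g => //; rewrite Pp.
  have -> : p = c *: vsproj S (act g hv).
    by apply: vsval_inj; rewrite vsvalZ vsprojK ?schur_act // pE vE linearZ.
  have c0 : c != 0 by apply: contraNneq hwv.1 => c0; rewrite vE c0 scale0r.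
  apply/eqP; rewrite eqEsubv -!memvE memvZ ?memv_line //=.
  by apply/vlineP; exists c^-1; rewrite scalerA mulVf // scale1r.
exists (vsproj S hv), g, (vsproj S (act g hv)); rewrite !vsprojK ?schur_act //.
by split=> //; apply: highest_tensor_hwv.
Qed.

Lemma schur_terracini s : (0 < s)%N ->
  exists r, [/\ (0 < r)%N,
    proj_dim (secant_variety s (@flag_variety K n la)) = r.-1 &
    general (@zariski_open_prod K E s) [set P | forall i, flag_variety (P i)]%classic
      (fun P => exists p, [/\ forall i, line (P i) = <[p i]>%VS,
        \rank (tangent_mx schur_lie p) = r &
        general (@zariski_open K E) (linear_span P) (fun Q => forall w,
          affine_tangent (secant_variety s (@flag_variety K n la)) Q w <->
          (crow w <= tangent_mx schur_lie p)%MS)])].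
Proof.
move=> s0; have hS := highest_tensor_schur K la_part la_size.
(* Coordinate functions are written as pairings with tensors, so the coordinates of an orbit point
   become values of [orbit_poly]. *)
have [w wE] : exists w : 'I_(ndim E) -> tens K n D,
    forall l t, crd (vsproj S t : E) l = dot (w l) t.
  have ex l : exists w, forall t, crd (vsproj S t : E) l = dot w t.
    by apply: scalar_dot => c t t'; rewrite linearP crdP.
  by have [w wE] := choice ex; exists w.
pose psi l := orbit_poly (w l) hv.
have pointE x : orbit_point psi x = vsproj S (act (mx_of_params x) hv).
  by apply: crd_inj => l; rewrite of_crdK orbit_polyE wE.
have velE x c : orbit_velocity psi x c = vsproj S
    (dact (mx_of_params x) (delta_mx (enum_val c).1 (enum_val c).2) hv).
  by apply: crd_inj => l; rewrite of_crdK mderiv_orbit_poly wE.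
have unitE x : ((\det (generic_mx K n)).@[x] != 0) = (mx_of_params x \in unitmx).
  by rewrite meval_det_generic unitmxE unitfE.
have vpoint x : mx_of_params x \in unitmx ->
    vsval (vsproj S (act (mx_of_params x) hv)) = act (mx_of_params x) hv.
  by move=> xU; rewrite vsprojK // schur_act.
apply: (@terracini K E _ s psi (\det (generic_mx K n))) => //.
- exact: det_generic_neq0.
- exact: schur_lie_linear.
- move=> x; rewrite unitE pointE => xU; apply/eqP=> /(congr1 vsval).
  rewrite vpoint // linear0 => /(congr1 (act (invmx (mx_of_params x)))).
  rewrite actK // linear0; apply/eqP; exact: highest_tensor_neq0.
- move=> P; rewrite flag_orbit; split=> [[g gU Pg]|[x]].
    by exists (params_of_mx g); rewrite ?unitE ?pointE params_of_mxK.
  by rewrite unitE pointE => xU Px; exists (mx_of_params x).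
- move=> x c; rewrite unitE velE pointE => xU; set g := mx_of_params x in xU *.
  (* Right translation by the inverse of [g] carries a direction at [g] to gl(V), the form that
     [dact_lie] expects. *)
  pose xi := delta_mx (enum_val c).1 (enum_val c).2 *m invmx g.
  exists (fun ij => xi ij.1 ij.2); apply: vsval_inj.
  have -> : delta_mx (enum_val c).1 (enum_val c).2 = xi *m g by rewrite mulmxKV.
  rewrite dact_lie -(vpoint x) // -/g vsprojK ?schur_lie_mem ?subvsP //.
  rewrite lie_schur_lie vsval_sum; apply: eq_bigr => ij _.
  by rewrite vsvalZ vsvalK.
- move=> x ij; rewrite unitE pointE => xU; set g := mx_of_params x in xU *.
  exists (fun c => (delta_mx ij.1 ij.2 *m g) (enum_val c).1 (enum_val c).2).
  rewrite /schur_lie (vpoint x) // -/g -dact_lie dact_sum_delta pair_bigA linear_sum /=.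
  rewrite (reindex (@enum_val ('I_n * 'I_n)%type predT)) /=; last first.
    exact/onW_bij/enum_val_bij.
  by apply: eq_bigr => c _; rewrite linearZ velE.
- move=> x; rewrite unitE pointE => xU; set u := vsproj _ _.
  exists (fun ij => #|{: seq_sub D}|%:R^-1 * (1%:M : 'M[K]_n) ij.1 ij.2).
  apply: vsval_inj; have := lie1 (vsval u); rewrite lie_schur_lie => H.
  rewrite vsval_sum -[LHS]scale1r -[in LHS](mulVf card_cells_neq0) -scalerA -H.
  rewrite scaler_sumr.
  by apply: eq_bigr => ij _; rewrite vsvalZ -scalerA.
Qed.

(** As [dot] is nondegenerate on the Schur module, its Gram matrix is invertible: every functional
    comes from a tensor of the module, and the annihilator has complementary dimension. *)
Lemma dim_annihilator s (p : 'I_s -> E) (U : {vspace tens K n D}) :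
  (forall phi, phi \in U <-> phi \in S /\
     forall i ij, dot phi (vsval (schur_lie ij (p i))) = 0) ->
  (\dim U + \rank (tangent_mx schur_lie p) = \dim S)%N.
Proof.
move=> UP; have dimM : ndim E = \dim S by rewrite /ndim dimvf.
pose e l : tens K n D := vsval (vbasis {:E})`_l.
have eS l : e l \in S by apply: subvsP.
have dotE phi (u : E) : dot phi (vsval u) = \sum_l crd u l * dot phi (e l).
  rewrite {1}[u]crdE vsval_sum linear_sum; apply: eq_bigr => l _.
  by rewrite vsvalZ linearZ.
have co_lin : linear (fun phi : tens K n D => \row_(l < ndim E) dot phi (e l)).
  by move=> c x y; apply/rowP=> l; rewrite !mxE dot_linearl.
pose co : {linear tens K n D -> 'rV[K]_(ndim E)} := HB.pack
  (fun phi : tens K n D => \row_(l < ndim E) dot phi (e l))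
  (GRing.isLinear.Build K (tens K n D) 'rV[K]_(ndim E) *:%R _ co_lin).
have coE phi l : co phi 0 l = dot phi (e l) by rewrite mxE.
have co_inj phi : phi \in S -> co phi = 0 -> phi = 0.
  move=> phiS co0; apply: (schur_dot_nondegenerate la_part la_size phiS) => w wS.
  rewrite -(vsprojK wS) dotE big1 // => l _.
  by rewrite -coE co0 mxE mulr0.
pose Gram : 'M[K]_(ndim E) := \matrix_l co (e l).
have comb (y : 'rV[K]_(ndim E)) : y *m Gram = co (\sum_l y 0 l *: e l).
  rewrite linear_sum mulmx_sum_row; apply: eq_bigr => l _.
  by rewrite linearZ rowK.
have GU : Gram \in unitmx.
  rewrite -row_free_unit -kermx_eq0; apply/eqP/row_matrixP => i; rewrite row0.
  set y := row i _; have : y *m Gram = 0 by rewrite -row_mul mulmx_ker row0.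
  rewrite comb => /co_inj y0; apply/rowP=> j; rewrite [RHS]mxE.
  have : \sum_l y 0 l *: (vbasis {:E})`_l = 0.
    apply: vsval_inj; rewrite vsval_sum linear0.
    under eq_bigr => l _ do rewrite vsvalZ.
    by apply: y0; apply: memv_suml => l _; apply: memvZ.
  by have /freeP/(_ (fun l => y 0 l)) ff := basis_free (vbasisP {:E}); move/ff; apply.
have coA phi : (co phi <= kermx (tangent_mx schur_lie p)^T)%MS <->
    forall i ij, dot phi (vsval (schur_lie ij (p i))) = 0.
  have AE : co phi *m (tangent_mx schur_lie p)^T =
      \row_k dot phi (vsval (schur_lie (enum_val k).2 (p (enum_val k).1))).
    apply/rowP=> k; rewrite [RHS]mxE dotE mxE; apply: eq_bigr => l _.
    by rewrite coE !mxE mulrC.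
  split=> [/sub_kermxP|H].
    rewrite AE => /rowP H i ij; have := H (enum_rank (i, ij)).
    by rewrite !mxE enum_rankK.
  by apply/sub_kermxP; rewrite AE; apply/rowP=> k; rewrite !mxE H.
rewrite (@dim_eq_rank _ _ U _ _ co (kermx (tangent_mx schur_lie p)^T)).
- rewrite mxrank_ker mxrank_tr subnK ?rank_leq_col //.
- by move=> phi /UP[phiS _]; apply: co_inj.
- by move=> phi /UP[_ H]; apply/coA.
- move=> k; set y := row k _; pose phi := \sum_l (y *m invmx Gram) 0 l *: e l.
  have cophi : co phi = y by rewrite -comb mulmxKV.
  exists phi => //; apply/UP; split.
    by apply: memv_suml => l _; apply: memvZ.
  by apply/coA; rewrite cophi row_sub.
Qed.

End SchurSecants.

Lemma perp_tangentP (K : numClosedFieldType) (n : nat) (la : seq nat) s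
    (la_part : is_partition la) (la_size : (size la <= n)%N)
    (p : 'I_s -> schur_space K n la) (U : set (schur_space K n la)) phi :
  (forall w, U w <-> (crow w <= tangent_mx (@schur_lie K n la) p)%MS) ->
  perp U phi <-> phi \in schur_dual K n la /\
    forall i ij, dot phi (vsval (schur_lie ij (p i))) = 0.
Proof.
move=> UP; split=> -[phiS phiU]; split=> //.
  move=> i ij; apply/apolar_self_eq0/phiU/UP; exact: crow_tau_sub.
move=> u /UP uA; apply/apolar_self_eq0.
apply: (@tangent_mx_functional _ _ _ _ (@schur_lie K n la) p
  (fun u => dot phi (vsval u))
  (fun l => dot phi (vsval (vbasis {:schur_space K n la})`_l))) uA => // v.
rewrite {1}[v]crdE vsval_sum linear_sum; apply: eq_bigr => l _.
by rewrite vsvalZ linearZ /= mulrC.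
Qed.

Lemma components_schur_squareP (K : numClosedFieldType) (n s : nat) (lam : part n)
    (P : 'I_s -> proj (schur_space K n (parts lam)))
    (p : 'I_s -> schur_space K n (parts lam)) phi :
  (0 < s)%N -> parts lam <> [::] -> (forall i, line (P i) = <[p i]>%VS) ->
  (\bigcap_(i in [set: 'I_s]) component (schur_square (P i)) lam)%classic phi <->
  phi \in schur_dual K n (parts lam) /\
    forall i ij, dot phi (vsval (schur_lie ij (p i))) = 0.
Proof.
move=> s0 lam0 Pp; have /andP[la_part la_size] := svalP lam; split=> [H|[phiS H] i _].
  split=> [|i].
    (* A point is needed here: the intersection over no points would be the whole tensor space. *)
    by have /component_schur_squareP[] := H (Ordinal s0) Logic.I.
  have /component_schur_squareP[_ /(_ (p i))] := H i Logic.I.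
  by rewrite Pp memv_line => /(_ isT)/dot_lie_all; apply.
apply/component_schur_squareP; split=> // q; rewrite Pp => /vlineP[c ->].
have [d0 dxi] := (dot_lie_all la_part la_size lam0 phi (p i)).2 (H i).
by rewrite vsvalZ; split=> [|xi]; rewrite !linearZ /= ?d0 ?dxi mulr0.
Qed.

Lemma lin_dimE (K : fieldType) (E : vectType K) (A : set E) (U : {vspace E}) :
  (forall v, A v <-> v \in U) -> lin_dim A = \dim U.
Proof.
move=> AU; have UA : [set` U]%classic = A.
  by apply/funext => v; apply/propext; rewrite AU.
rewrite /lin_dim; congr (\dim _); apply/vspaceP => v.
have := @xgetPex _ 0%VS [set U : {vspace E} | [set` U] = A]%classic
  (ex_intro _ U UA).
rewrite /= -[in RHS]UA => /(congr1 (fun B => B v)) /= vU.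
by apply/idP/idP; rewrite -[X in X -> _]/(is_true _) vU.
Qed.

Local Open Scope classical_set_scope.
Local Open Scope ring_scope.

Theorem corollary3p25 (R : realType) (n s : nat) (lam : part n)
    (lam_nonempty : parts lam <> [::])
    (lam_length : (size (parts lam) < n)%N)
    (s_ge1 : (1 <= s)%N) :
  general (@zariski_open_prod R[i] (schur_space R[i] n (parts lam)) s)
    [set P | forall i, flag_variety (P i)]
    (fun P =>
       general (@zariski_open R[i] (schur_space R[i] n (parts lam)))
         (linear_span P)
         (fun Q =>
            perp (affine_tangent
                    (secant_variety s (@flag_variety R[i] n (parts lam))) Q)
            = \bigcap_(i in [set: 'I_s]) component (schur_square (P i)) lam)
       /\
       (proj_dim (secant_variety s (@flag_variety R[i] n (parts lam))))%:Z
       = ((\dim (schur R[i] n (parts lam)))%:Z - 1)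
         - (lin_dim (\bigcap_(i in [set: 'I_s])
                       component (schur_square (P i)) lam))%:Z).
Proof.
have /andP[la_part la_size] := svalP lam.
have [r [r_gt0 -> gen]] :=
  @schur_terracini R[i] n (parts lam) la_part la_size lam_nonempty s s_ge1.
apply: general_imply gen => P _ [p [Pp rp genQ]].
have capP := components_schur_squareP _ s_ge1 lam_nonempty Pp.
split.
  apply: general_imply genQ => Q _ TQ; apply/funext => phi; apply/propext.
  by rewrite (perp_tangentP la_part la_size _ TQ) capP.
have [U UP] : exists U : {vspace tens R[i] n (diagram (parts lam))},
    forall phi, phi \in U <->
      (\bigcap_(i in [set: 'I_s]) component (schur_square (P i)) lam) phi.
  apply: vspace_of_pred => [|c u v /capP[uS u0] /capP[vS v0]]; apply/capP.
    split=> [|i ij]; first exact: mem0v.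
    by rewrite dotC linear0.
  split=> [|i ij]; first by rewrite memvD ?memvZ.
  by rewrite dot_linearl u0 v0 mulr0 addr0.
rewrite (lin_dimE (fun phi => iff_sym (UP phi))).
have dimU := dim_annihilator la_part la_size (p := p) (U := U).
rewrite -dimU => [|phi]; last by rewrite UP capP schur_dualE.
(* The cone has dimension [r] and the variety [r.-1]; positivity of [r] makes the natural
   predecessor exact. *)
rewrite rp (_ : (\dim U + r = r.-1 + \dim U + 1)%N) ?PoszD ?addrK //.
by rewrite addn1 -addSn prednK // addnC.
Qed.
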